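(* Let $P\subset\mathbb{R}^d$ be a rational $d$-polytope containing the origin in its interior, let $T$ be a boundary triangulation of $P$ with denominator $q$, and define $h^*(P;z)$ by $\mathrm{Ehr}(P;z)=\frac{h^*(P;z)}{(1-z^q)^{d+1}}$. Set $$a(z)=(1+z+\cdots+z^{q-1})\sum_{\Omega\in T}B(\Omega;z)\,h(\Omega;z^q),\qquad b(z)=z^{-1}(1+z+\cdots+z^{q-1})\sum_{\Omega\in T}B(\Omega';z)\,h(\Omega;z^q),$$ so that $h^*(P;z)=a(z)+z\,b(z)$. Then the dual polytope $P^*=\{\mathbf{y}:\langle\mathbf{x},\mathbf{y}\rangle\le1\ \forall\mathbf{x}\in P\}$ is a lattice polytope if and only if $b(z)=0$, i.e., if and only if $h^*(P;z)=a(z)$.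
   Context: $\mathrm{Ehr}(P;z)=\sum_{t\ge0}|tP\cap\mathbb{Z}^d|z^t$. A boundary triangulation $T$ of $P$ is a simplicial complex of simplices (including the empty simplex, of dimension $-1$) whose union is $\partial P$; its denominator $q$ is the lcm of vertex coordinate denominators of its simplices. Let $u$ be the last-coordinate projection on $\mathbb{R}^{d+1}$. For linearly independent $\mathbf{W}\subset\mathbb{Z}^{d+1}$, $B(\mathbf{W};z)=\sum z^{u(\mathbf{v})}$ over integer points $\mathbf{v}$ of $\{\sum_{\mathbf{w}\in\mathbf{W}}\lambda_{\mathbf{w}}\mathbf{w}:0<\lambda_{\mathbf{w}}<1\}$ ($0$ if none; $B(\emptyset;z)=1$). For $\Omega\in T$ with vertices $\mathbf{r}_1/q,\dots,\mathbf{r}_{m+1}/q$ ($\mathbf{r}_i\in\mathbb{Z}^d$), let $\mathbf{W}=\{(\mathbf{r}_i,q)\}$, $B(\Omega;z)=B(\mathbf{W};z)$ and $B(\Omega';z)=B(\mathbf{W}\cup\{(\mathbf{0},1)\};z)$ (so $B(\emptyset';z)=B(\{(\mathbf{0},1)\};z)=0$). The $h$-polynomial is $h(\Omega;z)=(1-z)^{d-1-\dim\Omega}\sum_{\Omega\subseteq\Phi\in T}\left(\frac{z}{1-z}\right)^{\dim\Phi-\dim\Omega}$. *)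

(* Defs.v *)
From HB Require Import structures.
From mathcomp Require Export all_boot all_order all_algebra fraction finmap.
From mathcomp Require Export all_classical all_reals topology normedtype.

Set Implicit Arguments.
Unset Strict Implicit.
Unset Printing Implicit Defensive.

Export Order.TTheory GRing.Theory Num.Theory.
Export numFieldNormedType.Exports.

Global Open Scope classical_set_scope.
Global Open Scope ring_scope.

Section Geometry.
Variables (R : realType) (d : nat).

Definition rat_to_real (v : 'rV[rat]_d) : 'rV[R]_d := map_mx ratr v.
Definition int_to_real (v : 'rV[int]_d) : 'rV[R]_d := map_mx intr v.

Definition conv (A : {fset 'rV[R]_d}) : set 'rV[R]_d :=
  [set x | exists lam : 'rV[R]_d -> R,
    [/\ forall v, v \in A -> 0 <= lam v,
        \sum_(v <- A) lam v = 1 &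
        x = \sum_(v <- A) lam v *: v]].

Definition affinely_independent (A : {fset 'rV[R]_d}) : Prop :=
  forall lam : 'rV[R]_d -> R,
    \sum_(v <- A) lam v = 0 -> \sum_(v <- A) lam v *: v = 0 ->
    forall v, v \in A -> lam v = 0.

Definition rational_polytope (P : set 'rV[R]_d) : Prop :=
  exists A : {fset 'rV[rat]_d}, P = conv [fset rat_to_real v | v in A]%fset.

Definition lattice_polytope (P : set 'rV[R]_d) : Prop :=
  exists A : {fset 'rV[int]_d}, P = conv [fset int_to_real v | v in A]%fset.

Definition dual (P : set 'rV[R]_d) : set 'rV[R]_d :=
  [set y | forall x, P x -> \sum_(i < d) x 0 i * y 0 i <= 1].

Definition boundary (P : set 'rV[R]_d) : set 'rV[R]_d :=
  closure P `\` interior P.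

(* |tP \cap Z^d| *)
Definition lattice_count (P : set 'rV[R]_d) (t : nat) : nat :=
  #|` fset_set [set v : 'rV[int]_d |
        ((fun x => t%:R *: x) @` P) (int_to_real v)]|.

(* Ehr(P;z) = hs(z) / (1 - z^q)^(d+1), as an identity of formal power series:
   the left-hand side is the n-th coefficient of (1 - z^q)^(d+1) Ehr(P;z). *)
Definition is_hstar (P : set 'rV[R]_d) (q : nat) (hs : {poly rat}) : Prop :=
  forall n : nat,
    \sum_(k < n.+1)
      ((1 - 'X^q) ^+ d.+1 : {poly rat})`_k * (lattice_count P (n - k))%:R
    = hs`_n.

(* A simplex is given by its vertex set, so dim Om = #|` Om| - 1 and the faces
   of Om are its subsets; [conv fset0] is empty. *)
Definition simplex (Om : {fset 'rV[rat]_d}) : {fset 'rV[R]_d} :=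
  [fset rat_to_real v | v in Om]%fset.

Definition boundary_triangulation
    (P : set 'rV[R]_d) (T : {fset {fset 'rV[rat]_d}}) : Prop :=
  [/\ fset0 \in T,
      forall Om, Om \in T -> affinely_independent (simplex Om),
      forall Om Psi, Om \in T -> (Psi `<=` Om)%fset -> Psi \in T,
      forall Om Phi, Om \in T -> Phi \in T ->
        exists Psi, [/\ (Psi `<=` Om)%fset, (Psi `<=` Phi)%fset &
          conv (simplex Om) `&` conv (simplex Phi) = conv (simplex Psi)] &
      \bigcup_(Om in [set` T]) conv (simplex Om) = boundary P].

End Geometry.

Definition denominator (d : nat) (T : {fset {fset 'rV[rat]_d}}) : nat :=
  \big[lcmn/1%N]_(Om <- T) \big[lcmn/1%N]_(v <- Om)
    \big[lcmn/1%N]_(i < d) absz (denq (v 0 i)).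

Notation ratfun := {fraction {poly rat}}.
Definition polyF (p : {poly rat}) : ratfun := tofrac p.

Section BoxPolynomials.
Variables (R : realType) (d : nat).

Definition u (v : 'rV[int]_(d + 1)) : int := v 0 (rshift d ord0).

Definition open_box (W : {fset 'rV[int]_(d + 1)}) : set 'rV[int]_(d + 1) :=
  [set v | exists lam : 'rV[int]_(d + 1) -> R,
    (forall w, w \in W -> 0 < lam w < 1) /\
    int_to_real R v = \sum_(w <- W) lam w *: int_to_real R w].

Definition boxB (W : {fset 'rV[int]_(d + 1)}) (z : ratfun) : ratfun :=
  \sum_(v \in open_box W) z ^ u v.

(* (r, q) with v = r / q; [numq] reads off the integer q * v_i. *)
Definition lift_vertex (q : nat) (v : 'rV[rat]_d) : 'rV[int]_(d + 1) :=
  row_mx (\row_i numq (q%:R * v 0 i)) (const_mx q%:Z).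

Definition apex : 'rV[int]_(d + 1) := row_mx 0 (const_mx 1).

Definition coneW (q : nat) (Om : {fset 'rV[rat]_d}) : {fset 'rV[int]_(d + 1)} :=
  [fset lift_vertex q v | v in Om]%fset.

Definition B (q : nat) (Om : {fset 'rV[rat]_d}) (z : ratfun) : ratfun :=
  boxB (coneW q Om) z.

Definition B' (q : nat) (Om : {fset 'rV[rat]_d}) (z : ratfun) : ratfun :=
  boxB (apex |` coneW q Om)%fset z.

(* d - 1 - dim Om = d - #|` Om|, which is nonnegative for the simplices of a
   boundary triangulation. *)
Definition h (T : {fset {fset 'rV[rat]_d}}) (Om : {fset 'rV[rat]_d})
    (z : ratfun) : ratfun :=
  (1 - z) ^+ (d - #|` Om|) *
  \sum_(Phi <- T | (Om `<=` Phi)%fset) (z / (1 - z)) ^+ (#|` Phi| - #|` Om|).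

Definition a_fun (T : {fset {fset 'rV[rat]_d}}) (z : ratfun) : ratfun :=
  let q := denominator T in
  (\sum_(i < q) z ^+ i) * \sum_(Om <- T) B q Om z * h T Om (z ^+ q).

Definition b_fun (T : {fset {fset 'rV[rat]_d}}) (z : ratfun) : ratfun :=
  let q := denominator T in
  z^-1 * (\sum_(i < q) z ^+ i) * \sum_(Om <- T) B' q Om z * h T Om (z ^+ q).

End BoxPolynomials.

(* Main.v *)
(** Radial projection onto the boundary splits the cone over [P x {1}] into the relatively open
    cones over the simplices of [T]: every [x] is a positive combination [sum lam_v v] of the
    vertices of a unique simplex, and [x] lies in [tP] iff [s(x) := sum lam_v <= t].  Reducing
    the coordinates of the integer points of these cones modulo 1 gives the formula for
    [h*(P; z)], and it shows that, up to the factor [(1 - z^q)^(d+1)], the series [z b(z)]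
    counts the integer points [(x, t)] of the cone over [P] with [t - s(x)] not an integer.
    Its coefficients are nonnegative, so [b = 0] iff [s] is integral on [Z^d].  Since [s] is
    the support function of [P*], this holds when [P*] is a lattice polytope; conversely, [s]
    is linear on each full-dimensional cone, integrality makes the linear forms integral, and
    [P*] is the convex hull of these forms. *)

Require Import Defs.
From mathcomp Require Import ring lra zify.

Set Implicit Arguments.
Unset Strict Implicit.
Unset Printing Implicit Defensive.

(** * Convexity and separation *)

(** Over the cone of a simplex, a point of height [t] above [x] is [mu (0,1) + sum nu_v (q v, q)],
    with [s(x) = q sum nu_v], so the coordinate of the apex is [mu = t - s(x)]. Since the apex has
    height 1, nonnegative [mu] reduces to [mu = 0] or [0 < mu < 1]; the first case is the source of
    [a], the second of [z b]. This is why a nonintegral [t - s(x)] is what [b] detects. Power series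
    are coefficient sequences tied to rational functions by [is_gf]: the identities are proved in
    the field of fractions, while nonnegativity is available only for the coefficients. On the
    geometric side no face theory of polytopes is used. Gordan's alternative gives separation, hence
    closedness and the bidual. The simplices with [d] vertices stand in for facets; since a boundary
    triangulation is not assumed to be pure, the obstacle is to show that their closed cones cover
    the space. *)

Definition dot (R : realType) d (x y : 'rV[R]_d) : R := \sum_(i < d) x 0 i * y 0 i.

Section Convexity.
Variables (R : realType) (d : nat).
Implicit Types (x y p f : 'rV[R]_d) (A : {fset 'rV[R]_d}) (P : set 'rV[R]_d).

Lemma dotDl x y f : dot (x + y) f = dot x f + dot y f.
Proof. by rewrite /dot -big_split; apply: eq_bigr => i _; rewrite !mxE mulrDl. Qed.

Lemma dotC x y : dot x y = dot y x.
Proof. by apply: eq_bigr => i _; rewrite mulrC. Qed.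

Lemma dotZl a x f : dot (a *: x) f = a * dot x f.
Proof. by rewrite /dot mulr_sumr; apply: eq_bigr => i _; rewrite !mxE mulrA. Qed.

Lemma dotDr x y f : dot f (x + y) = dot f x + dot f y.
Proof. by rewrite dotC dotDl !(dotC f). Qed.

Lemma dotZr a x f : dot f (a *: x) = a * dot f x.
Proof. by rewrite dotC dotZl !(dotC f). Qed.

Lemma dot0l f : dot 0 f = 0.
Proof. by rewrite -(scale0r 0) dotZl mul0r. Qed.

Lemma dotBl x y f : dot (x - y) f = dot x f - dot y f.
Proof. by rewrite dotDl -scaleN1r dotZl mulN1r. Qed.

Lemma dot_suml (I : Type) (s : seq I) (F : I -> 'rV[R]_d) f :
  dot (\sum_(i <- s) F i) f = \sum_(i <- s) dot (F i) f.
Proof.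
by elim: s => [|i s IH]; rewrite ?big_nil ?dot0l // !big_cons dotDl IH.
Qed.

Lemma dot_lincomb (I : Type) (s : seq I) (lam : I -> R) (F : I -> 'rV[R]_d) f :
  dot (\sum_(i <- s) lam i *: F i) f = \sum_(i <- s) lam i * dot (F i) f.
Proof. by rewrite dot_suml; apply: eq_bigr => i _; rewrite dotZl. Qed.

Lemma dot_gt0 x : x != 0 -> 0 < dot x x.
Proof.
move=> x0; rewrite lt_def sumr_ge0 ?andbT; last by move=> i _; rewrite -expr2 sqr_ge0.
apply: contra x0; rewrite psumr_eq0; last by move=> i _; rewrite -expr2 sqr_ge0.
move=> /allP x0; apply/eqP/rowP => i; rewrite mxE.
by have := x0 i (mem_index_enum i); rewrite mulf_eq0 orbb => /eqP.
Qed.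

Lemma dot_le_norm x f e :
  (forall i, `|x 0 i| <= e) -> `|dot x f| <= e * \sum_i `|f 0 i|.
Proof.
move=> xe; rewrite mulr_sumr; apply: le_trans (ler_norm_sum _ _ _) _.
by apply: ler_sum => i _; rewrite normrM ler_wpM2r.
Qed.

Lemma seq_upper_bound (I : eqType) (s : seq I) (l : I -> R) :
  exists b, forall i, i \in s -> l i < b.
Proof.
elim: s => [|i s [b lb]]; first by exists 0.
exists (Num.max b (l i + 1)) => j; rewrite inE => /orP[/eqP ->|/lb h].
  by rewrite lt_max ltrDl ltr01 orbT.
by rewrite lt_max h.
Qed.

(** Finiteness leaves a gap below [b]; this upgrades a separation that is strict at each generator
    to a uniform one. *)
Lemma seq_strict_bound (I : eqType) (s : seq I) (l : I -> R) b :
  (forall i, i \in s -> l i < b) ->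
  exists2 t, t < b & forall i, i \in s -> l i < t.
Proof.
elim: s => [|i s IH] lb; first by exists (b - 1) => //; rewrite ltrBlDr ltrDl ltr01.
have [|t tb lt] := IH; first by move=> j js; apply: lb; rewrite inE js orbT.
have li := lb i (mem_head _ _).
exists (Num.max t ((l i + b) / 2)); first by rewrite gt_max tb /=; lra.
move=> j; rewrite inE lt_max => /orP[/eqP ->|/lt -> //].
by apply/orP; right; lra.
Qed.

Lemma sumr_weight_gt0 (I : eqType) (s : seq I) (lam k : I -> R) :
  (forall i, i \in s -> 0 <= lam i) -> (forall i, i \in s -> 0 < k i) ->
  0 < \sum_(i <- s) lam i -> 0 < \sum_(i <- s) lam i * k i.
Proof.
elim: s => [|i s IH] l0 k0; first by rewrite !big_nil.
have l0s j : j \in s -> 0 <= lam j by move=> js; apply: l0; rewrite inE js orbT.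
have k0s j : j \in s -> 0 < k j by move=> js; apply: k0; rewrite inE js orbT.
have li := l0 i (mem_head _ _); have ki := k0 i (mem_head _ _).
rewrite !big_cons => sum0.
have s0 : 0 <= \sum_(j <- s) lam j * k j.
  by rewrite big_seq sumr_ge0 // => j js; rewrite mulr_ge0 ?l0s // ltW ?k0s.
have [s1|s1] := ltP 0 (\sum_(j <- s) lam j).
  have := IH l0s k0s s1; have := mulr_ge0 li (ltW ki); lra.
have l1 : 0 < lam i by lra.
by have := mulr_gt0 l1 ki; lra.
Qed.

(* Induction on the family: a functional positive on the tail either also works
   for the head, or is used to project the tail along the head. *)
Lemma gordan (I : eqType) (s : seq I) (c : I -> 'rV[R]_d) : uniq s ->
  (exists f, forall i, i \in s -> 0 < dot (c i) f) \/
  (exists lam : I -> R, [/\ forall i, i \in s -> 0 <= lam i,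
     0 < \sum_(i <- s) lam i & \sum_(i <- s) lam i *: c i = 0]).
Proof.
elim: s c => [|i s IH] c; first by left; exists 0.
move=> /= /andP[iNs us].
have sum_ext (V : zmodType) (G : I -> V) v :
    \sum_(j <- i :: s) (if j == i then v else G j) = v + \sum_(j <- s) G j.
  rewrite big_cons eqxx; congr (_ + _); apply: eq_big_seq => j js.
  by case: eqP => // ji; rewrite -ji js in iNs.
have sum_extZ (l : I -> R) v : \sum_(j <- i :: s) (if j == i then v else l j) *: c j
    = v *: c i + \sum_(j <- s) l j *: c j.
  rewrite big_cons eqxx; congr (_ + _); apply: eq_big_seq => j js.
  by case: eqP => // ji; rewrite -ji js in iNs.
have [ci0|ci0] := eqVneq (c i) 0.
  right; exists (fun j => if j == i then 1 else 0); split.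
  - by move=> j _; case: ifP.
  - by rewrite (sum_ext _ (fun=> 0)) // big1 // addr0 ltr01.
  - by rewrite (sum_extZ (fun=> 0)) ci0 scaler0 add0r big1 // => j _; rewrite scale0r.
case: (IH c us) => [[x xp]|[lam [l0 l1 lc]]]; last first.
  right; exists (fun j => if j == i then 0 else lam j); split.
  - by move=> j; rewrite inE; case: eqP => //= _; apply: l0.
  - by rewrite sum_ext // add0r.
  - by rewrite sum_extZ scale0r add0r.
set a := dot (c i) x; have [a0|a0] := ltP 0 a.
  by left; exists x => j; rewrite inE => /orP[/eqP -> //|/xp].
(* These vectors are orthogonal to [x], and both weights are nonnegative because [a <= 0]; a
   relation among them is therefore a nonnegative relation among the original vectors. *)
case: (IH (fun j => (- a) *: c j + dot (c j) x *: c i) us)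
    => [[x' x'p]|[lam [l0 l1 lc]]]; last first.
  right; exists (fun j => if j == i then \sum_(k <- s) lam k * dot (c k) x
                          else - a * lam j).
  have sp := sumr_weight_gt0 l0 xp l1; split.
  - move=> j; rewrite inE; case: eqP => /= _; first by rewrite ltW.
    by move=> js; rewrite mulr_ge0 ?oppr_ge0 // l0.
  - rewrite sum_ext // -mulr_sumr ltr_pwDl // mulr_ge0 ?oppr_ge0 //.
    exact: ltW.
  - rewrite sum_extZ scaler_suml -big_split /= -[RHS]lc; apply: eq_bigr => j _.
    by rewrite scalerDr !scalerA addrC (mulrC (lam j) (- a)).
have [/nilP s0|s0] := boolP (nilp s).
  by left; exists (c i) => j; rewrite s0 inE => /eqP ->; apply: dot_gt0.
left; set b := dot (c i) x'.
have x'pE j : j \in s -> 0 < - a * dot (c j) x' + dot (c j) x * b.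
  by move=> js; have := x'p j js; rewrite dotDl !dotZl.
(* In [x' + t *: x] the tail bounds [t] from below and, if [a < 0], the head bounds it from above;
   [x'pE] says that these bounds are compatible. If [a = 0], it gives [0 < b] instead. *)
suff [t ta tl] : exists2 t, 0 < b + t * a &
    forall j, j \in s -> - dot (c j) x' / dot (c j) x < t.
  exists (x' + t *: x) => j; rewrite dotDr dotZr inE => /orP[/eqP -> //|js].
  by have := tl j js; rewrite ltr_pdivrMr ?xp //; lra.
move: a0; rewrite le_eqVlt => /orP[/eqP a0|a0].
  have b0 : 0 < b.
    case: s s0 xp x'pE {IH iNs us sum_ext sum_extZ x'p} => // j s _ xp x'p.
    have := x'p j (mem_head _ _); rewrite a0 oppr0 mul0r add0r pmulr_rgt0 //.
    by apply: xp; rewrite mem_head.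
  have [t tl] := seq_upper_bound s (fun j => - dot (c j) x' / dot (c j) x).
  by exists t => //; rewrite a0 mulr0 addr0.
have [|t tb tl] := @seq_strict_bound _ s (fun j => - dot (c j) x' / dot (c j) x) (b / - a).
  move=> j js; rewrite ltr_pdivrMr ?xp // mulrAC ltr_pdivlMr ?oppr_gt0 //.
  by have := x'pE j js; lra.
exists t => //; move: tb; rewrite ltr_pdivlMr ?oppr_gt0 //; lra.
Qed.

(** Gordan's alternative for the vectors [p - a]: a vanishing nonnegative combination of them, once
    normalized, writes [p] as a convex combination. *)
Lemma conv_separation A p : ~ conv A p ->
  exists f, forall a, a \in A -> dot a f < dot p f.
Proof.
move=> pNA; case: (@gordan _ A (fun a => p - a) (fset_uniq A)) => [[f fp]|].
  by exists f => a /fp; rewrite dotBl subr_gt0.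
case=> lam [l0 l1 lp]; exfalso; apply: pNA.
set L := \sum_(i <- A) lam i in l1; have Ln0 : L != 0 by rewrite gt_eqF.
exists (fun a => L^-1 * lam a); split.
- by move=> a aA; rewrite mulr_ge0 ?l0 // invr_ge0 ltW.
- by rewrite -mulr_sumr mulVf.
- move: lp; under eq_bigr do rewrite scalerBr.
  rewrite sumrB -scaler_suml => /subr0_eq lp.
  under eq_bigr do rewrite -scalerA.
  by rewrite -scaler_sumr -lp scalerA mulVf // scale1r.
Qed.

Lemma conv_dot_le A f t : (forall a, a \in A -> dot a f <= t) ->
  forall x, conv A x -> dot x f <= t.
Proof.
move=> ft x [lam [l0 l1 ->]]; rewrite dot_lincomb.
rewrite -[t]mul1r -l1 mulr_suml !big_seq; apply: ler_sum => a aA.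
by rewrite ler_wpM2l ?l0 ?ft.
Qed.

Lemma conv_convex A x y (r : R) : 0 <= r <= 1 ->
  conv A x -> conv A y -> conv A (r *: x + (1 - r) *: y).
Proof.
move=> /andP[r0 r1] [l [l0 l1 ->]] [m [m0 m1 ->]].
exists (fun a => r * l a + (1 - r) * m a); split.
- by move=> a aA; rewrite addr_ge0 ?mulr_ge0 ?l0 ?m0 // subr_ge0.
- by rewrite big_split /= -!mulr_sumr l1 m1; ring.
- rewrite !scaler_sumr -big_split /=; apply: eq_bigr => a _.
  by rewrite !scalerA -scalerDl.
Qed.

Lemma conv_gen A a : a \in A -> conv A a.
Proof.
move=> aA; exists (fun b => (b == a)%:R); split.
- by move=> b _; case: eqP.
- rewrite (big_fsetD1 a) //= eqxx big_seq big1 ?addr0 // => b.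
  by rewrite !inE => /andP[/negPf ->].
- rewrite (big_fsetD1 a) //= eqxx scale1r big_seq big1 ?addr0 // => b.
  by rewrite !inE => /andP[/negPf ->]; rewrite scale0r.
Qed.

Lemma conv_bounded A : exists b, forall x i, conv A x -> `|x 0 i| <= b.
Proof.
have [b hb] := @seq_upper_bound _ A (fun a => \sum_i `|a 0 i|).
exists b => x i [lam [l0 l1 ->]]; rewrite summxE.
apply: le_trans (ler_norm_sum _ _ _) _.
rewrite -[b]mul1r -l1 mulr_suml !big_seq; apply: ler_sum => a aA.
rewrite mxE normrM (ger0_norm (l0 _ aA)) ler_wpM2l ?l0 //.
apply: le_trans (ltW (hb a aA)); rewrite (bigD1 i) //= lerDl.
exact: sumr_ge0.
Qed.

Lemma nbhs_rowP x P : nbhs x P <->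
  exists2 e : R, 0 < e & forall y, (forall i, `|x 0 i - y 0 i| < e) -> P y.
Proof.
split=> [/nbhs_ballP[e /= e0 eP]|[e e0 eP]].
  exists e => // y xy; apply: eP; split=> // i j.
  by rewrite ord1 /ball /= ; apply: xy.
apply/nbhs_ballP; exists e => // y [_ xy]; apply: eP => i; exact: xy.
Qed.

Lemma conv_closed A : closure (conv A) `<=` conv A.
Proof.
move=> p pA; apply: contrapT => /conv_separation[f fA].
have [t tp tA] := seq_strict_bound fA.
set S := \sum_i `|f 0 i|; have S0 : 0 <= S by apply: sumr_ge0.
(* Moving each coordinate by at most [e] changes the value of [f] by at most [e * S], less than the
   gap above [t]; the [+ 1] keeps the denominator positive when [f = 0]. *)
pose e := (dot p f - t) / (S + 1).
have e0 : 0 < e by rewrite divr_gt0 ?subr_gt0 // ltr_wpDl.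
have [y [yA ye]] : conv A `&` [set y | forall i, `|p 0 i - y 0 i| < e] !=set0.
  by apply: pA; apply/nbhs_rowP; exists e.
have yt : dot y f <= t by apply: (@conv_dot_le A) yA => a /tA/ltW.
have := @dot_le_norm (p - y) f e; rewrite dotBl => h.
have {}h : `|dot p f - dot y f| <= e * S.
  by apply: h => i; rewrite !mxE; apply/ltW/ye.
have : e * (S + 1) = dot p f - t by rewrite /e divfK // gt_eqF // ltr_wpDl.
have := ler_norm (dot p f - dot y f); lra.
Qed.

(** * Rays from the interior origin and the boundary *)

Section Radial.
Variable A : {fset 'rV[R]_d}.
Let P := conv A.
Hypothesis P0 : interior P 0.

Let PO : P 0.
Proof. exact: interior_subset. Qed.

Lemma conv_star x (r : R) : 0 <= r <= 1 -> P x -> P (r *: x).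
Proof.
by move=> r01 Px; rewrite -[_ *: _]addr0 -(scaler0 _ (1 - r)); apply: conv_convex.
Qed.

(** For a neighbourhood [U] of 0 inside [P], convexity puts [r x + (1 - r) U] into [P], and this is
    a neighbourhood of [r x]. *)
Lemma conv_shrink_interior x (r : R) : 0 <= r < 1 -> P x -> interior P (r *: x).
Proof.
move=> /andP[r0 r1] Px; have /nbhs_rowP[e e0 eP] := P0.
have r1' : 0 < 1 - r by rewrite subr_gt0.
apply/nbhs_rowP; exists ((1 - r) * e); first by rewrite mulr_gt0.
move=> y ye; have -> : y = r *: x + (1 - r) *: ((1 - r)^-1 *: (y - r *: x)).
  by rewrite scalerA divff ?gt_eqF // scale1r addrC subrK.
apply: conv_convex => //; first by rewrite r0 ltW.
apply: eP => i; rewrite !mxE sub0r normrN normrM distrC.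
rewrite gtr0_norm ?invr_gt0 // mulrC ltr_pdivrMr // mulrC.
by have := ye i; rewrite !mxE (mulrC r) (mulrC e).
Qed.

Lemma boundary_conv c : boundary P c -> P c.
Proof. by case=> /conv_closed. Qed.

Lemma boundary_radial c (r : R) : boundary P c -> P (r *: c) -> r <= 1.
Proof.
move=> [_ cNi] Prc; rewrite leNgt; apply/negP => r1; apply: cNi.
have r0 : 0 < r by apply: lt_trans r1.
have -> : c = r^-1 *: (r *: c) by rewrite scalerA mulVf ?scale1r // gt_eqF.
by apply: conv_shrink_interior => //; rewrite invr_ge0 ltW //= invf_lt1.
Qed.

(** The ray leaves [P] at the supremum of the admissible factors: finite since [P] is bounded,
    positive since 0 is interior. The point there is a limit of points of [P], and it is not
    interior, as otherwise a larger factor would be admissible. *)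
Lemma boundary_ray x : x != 0 -> exists2 s : R, 0 < s & boundary P (s *: x).
Proof.
move=> x0; pose E := [set r : R | P (r *: x)].
have [i xi0] : exists i, x 0 i != 0.
  apply/existsP; apply: contraNT x0; rewrite negb_exists => /forallP x0.
  by apply/eqP/rowP => i; rewrite mxE; apply/eqP; have := x0 i; rewrite negbK.
have E0 : E 0 by rewrite /E /= scale0r.
have [b bP] := conv_bounded A.
have xi : 0 < `|x 0 i| by rewrite normr_gt0.
have supE : has_sup E.
  split; first by exists 0.
  exists (b / `|x 0 i|) => r Er; have := bP _ i Er; rewrite mxE normrM => h.
  by rewrite ler_pdivlMr // (le_trans _ h) // ler_wpM2r // ler_norm.
pose M := \sum_j `|x 0 j| + 1.
have M0 : 0 < M by rewrite ltr_wpDl // sumr_ge0.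
have xM j : `|x 0 j| < M.
  by rewrite /M (bigD1 j) //= -addrA ltrDl ltr_wpDl // sumr_ge0.
have near (r e : R) : 0 < e -> exists2 k, 0 < k &
    forall t, `|r - t| <= k -> forall j, `|(r *: x) 0 j - (t *: x) 0 j| < e.
  move=> e0; exists (e / M); first by rewrite divr_gt0.
  move=> t rt j; rewrite !mxE -mulrBl normrM.
  have [->|xj] := eqVneq (x 0 j) 0; first by rewrite normr0 mulr0.
  apply: le_lt_trans (_ : e / M * `|x 0 j| < e); first by rewrite ler_wpM2r.
  by rewrite mulrAC ltr_pdivrMr // ltr_pM2l.
have step r : interior P (r *: x) -> exists2 t, r < t & E t.
  move=> /nbhs_rowP[e e0 eP]; have [k k0 kP] := near r e e0.
  exists (r + k); first by rewrite ltrDl.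
  by apply/eP/kP; rewrite opprD addrA subrr sub0r normrN gtr0_norm.
have [t t0 Et] : exists2 t, 0 < t & E t by apply: step; rewrite scale0r.
have s0 : 0 < sup E by apply: lt_le_trans t0 (ub_le_sup _ Et); case: supE.
exists (sup E) => //; split.
  move=> B /nbhs_rowP[e e0 eB]; have [k k0 kP] := near (sup E) e e0.
  have [r Er sr] := sup_adherent k0 supE.
  exists (r *: x); split=> //; apply/eB/kP.
  have rs : r <= sup E by apply: ub_le_sup Er; case: supE.
  by rewrite ger0_norm ?subr_ge0 //; lra.
move=> /step[r sr Er]; have : r <= sup E by apply: ub_le_sup Er; case: supE.
by rewrite leNgt sr.
Qed.

End Radial.
End Convexity.

(** * Finite families of vectors *)

Section Transfer.
Variables (R : realType) (I J : choiceType) (g : I -> J) (S : {fset I}).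
Hypothesis g_inj : {in S &, injective g}.

(** Hulls and boxes index coefficients by image vectors, the proof indexes them by the vertices
    before mapping. Summing over the fibre of [g] avoids choosing an inverse. *)
Lemma extend_along_injection (lam : I -> R) :
  exists mu : J -> R, forall v, v \in S -> mu (g v) = lam v.
Proof.
exists (fun w => \sum_(v <- S) (if g v == w then lam v else 0)) => v vS.
rewrite (big_fsetD1 v) //= eqxx big_seq big1 ?addr0 // => w.
rewrite !inE => /andP[wv wS]; case: eqP => // /(g_inj wS vS) wvE.
by rewrite wvE eqxx in wv.
Qed.

Lemma sum_imfset (V : nmodType) (F : J -> V) :
  \sum_(w <- [fset g v | v in S]%fset) F w = \sum_(v <- S) F (g v).
Proof. by rewrite big_imfset. Qed.

End Transfer.

Section LinearIndependence.
Variables (R : realType) (d : nat) (I : choiceType) (S : {fset I}) (g : I -> 'rV[R]_d).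

(** Stated for a family rather than a set of vectors, so that it serves both rational vertices and
    integer vectors read in the reals. *)
Definition linearly_independent := forall lam : I -> R,
  \sum_(v <- S) lam v *: g v = 0 -> forall v, v \in S -> lam v = 0.

Variable i0 : I.

Let M : 'M[R]_(size S, d) := \matrix_i g (nth i0 S i).

Lemma coordinates_of_row (u : 'rV[R]_(size S)) :
  exists lam : I -> R, (forall i : 'I_(size S), lam (nth i0 S i) = u 0 i) /\
    u *m M = \sum_(v <- S) lam v *: g v.
Proof.
exists (fun v => if insub (index v S) is Some i then u 0 i else 0).
have lamE (i : 'I_(size S)) :
    (if insub (index (nth i0 S i) S) is Some i then u 0 i else 0) = u 0 i.
  by rewrite index_uniq ?fset_uniq ?ltn_ord // valK.
split=> //; rewrite mulmx_sum_row (big_nth i0) big_mkord; apply: eq_bigr => i _.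
by rewrite lamE rowK.
Qed.

Hypothesis indep : linearly_independent.

Let M_free : row_free M.
Proof.
apply: inj_row_free => u uM0; have [lam [lamE uME]] := coordinates_of_row u.
apply/rowP => i; rewrite mxE -lamE; apply: indep; first by rewrite -uME.
exact: mem_nth.
Qed.

Lemma indep_card_le : (#|` S| <= d)%N.
Proof. by rewrite -(eqP M_free) rank_leq_col. Qed.

Lemma indep_interpolation (val : I -> R) :
  exists f, forall v, v \in S -> dot (g v) f = val v.
Proof.
have [B MB] := row_freeP M_free.
exists (B *m \col_i val (nth i0 S i))^T => v vS.
have iS : (index v S < size S)%N by rewrite index_mem.
have /matrixP/(_ (Ordinal iS) 0) :
    M *m (B *m \col_i val (nth i0 S i)) = \col_i val (nth i0 S i).
  by rewrite mulmxA MB mul1mx.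
rewrite !mxE /= nth_index // => <-; apply: eq_bigr => j _.
by rewrite !mxE /= nth_index.
Qed.

Lemma indep_annihilator : (#|` S| < d)%N ->
  exists2 f, f != 0 & forall v, v \in S -> dot (g v) f = 0.
Proof.
move=> Sd; exists (nz_row (kermx M^T)).
  rewrite nz_row_eq0 -mxrank_eq0 mxrank_ker mxrank_tr (eqP M_free) subn_eq0.
  by rewrite -ltnNge.
have /sub_kermxP/matrixP fM := nz_row_sub (kermx M^T) => v vS.
have iS : (index v S < size S)%N by rewrite index_mem.
have := fM 0 (Ordinal iS); rewrite !mxE /= => fM0; rewrite dotC -[RHS]fM0.
by apply: eq_bigr => j _; rewrite !mxE /= nth_index.
Qed.

Lemma indep_spanning : #|` S| = d ->
  forall x, exists lam : I -> R, x = \sum_(v <- S) lam v *: g v.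
Proof.
move=> Sd x; have Mfull : row_full M by rewrite /row_full (eqP M_free); apply/eqP.
have /submxP[u ->] := submx_full x Mfull.
by have [lam [_ ->]] := coordinates_of_row u; exists lam.
Qed.

End LinearIndependence.

(** * Signs of polynomials to the right of zero *)

Section PolynomialSign.
Variable R : realType.
Implicit Type p : {poly R}.

Lemma poly_neg_near0 p : p.[0] < 0 ->
  exists2 e : R, 0 < e & forall t, 0 < t < e -> p.[t] < 0.
Proof.
elim/poly_ind: p => [|p c _]; first by rewrite horner0 ltxx.
rewrite hornerMXaddC mulr0 add0r => c0.
have [b bP] := poly_itv_bound p 0 1.
have b0 : 0 <= b by apply: le_trans (bP 0 _); rewrite // lexx ler01.
exists (Num.min 1 (- c / (b + 1))).
  by rewrite lt_min ltr01 divr_gt0 ?oppr_gt0 // ltr_wpDl.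
move=> t; rewrite lt_min => /and3P[t0 t1 tb].
rewrite hornerMXaddC; move: tb; rewrite ltr_pdivlMr ?ltr_wpDl // => tb.
have : p.[t] <= b.
  by apply: le_trans (ler_norm _) (bP _ _); rewrite !ltW.
by rewrite -(ler_pM2r t0) => h; lra.
Qed.

(** Dividing out factors ['X] keeps the sign at positive points and ends at a nonzero constant term,
    which decides. *)
Lemma poly_sign_near0 p : p != 0 -> exists2 e : R, 0 < e &
  (forall t, 0 < t < e -> p.[t] < 0) \/ (forall t, 0 < t < e -> 0 < p.[t]).
Proof.
elim/poly_ind: p => [|p c IH]; first by rewrite eqxx.
move=> p0; have [c0|c0|c0] := ltgtP c 0.
- have [|e e0 eP] := @poly_neg_near0 (p * 'X + c%:P).
    by rewrite hornerMXaddC mulr0 add0r.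
  by exists e => //; left.
- have [|e e0 eP] := @poly_neg_near0 (- (p * 'X + c%:P)).
    by rewrite hornerN hornerMXaddC mulr0 add0r oppr_lt0.
  by exists e => //; right => t /eP; rewrite hornerN oppr_lt0.
- have [|e e0 eP] := IH.
    by apply: contra p0 => /eqP ->; rewrite c0 mul0r add0r.
  exists e => //; case: eP => eP; [left|right] => t /[dup] te /eP;
    rewrite hornerMXaddC c0 addr0; case/andP: te => t0 _.
    by rewrite pmulr_llt0.
  by rewrite pmulr_lgt0.
Qed.

Lemma seq_eventually (I : eqType) (s : seq I) (Q : I -> R -> Prop) :
  (forall i, i \in s -> exists2 e : R, 0 < e & forall t, 0 < t < e -> Q i t) ->
  exists2 t, 0 < t & forall i, i \in s -> Q i t.
Proof.
move=> H; suff [e e0 eQ] : exists2 e : R, 0 < e &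
    forall t, 0 < t < e -> forall i, i \in s -> Q i t.
  by exists (e / 2); [lra|apply: eQ; lra].
elim: s H => [|i s IH] H; first by exists 1.
have [|e e0 eQ] := IH; first by move=> j js; apply: H; rewrite inE js orbT.
have [e' e'0 e'Q] := H i (mem_head _ _).
exists (Num.min e e'); first by rewrite lt_min e0.
move=> t; rewrite lt_min => /and3P[t0 te te'] j; rewrite inE.
by case/orP => [/eqP ->|]; [apply: e'Q; rewrite t0|apply: eQ; rewrite t0].
Qed.

End PolynomialSign.

(** * Cones over a boundary triangulation *)

Lemma rat_to_real_inj (R : realType) d : injective (@rat_to_real R d).
Proof.
move=> v w /rowP vw; apply/rowP => i.
by have := vw i; rewrite !mxE => /fmorph_inj.
Qed.

Section Simplices.
Variables (R : realType) (d : nat).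
Implicit Types (Om Phi Psi : {fset 'rV[rat]_d}) (lam : 'rV[rat]_d -> R).
Local Notation rr := (@rat_to_real R d).

Let rr_in Om : {in Om &, injective rr}.
Proof. by move=> v w _ _; apply: rat_to_real_inj. Qed.

Lemma conv_simplexP Om x : conv (simplex R Om) x <->
  exists lam, [/\ forall v, v \in Om -> 0 <= lam v,
    \sum_(v <- Om) lam v = 1 & x = \sum_(v <- Om) lam v *: rr v].
Proof.
split=> [[lam [l0]]|[lam [l0 l1 lx]]].
  rewrite !sum_imfset // => l1 lx; exists (fun v => lam (rr v)); split=> // v vO.
  by apply: l0; rewrite in_imfset.
have [mu muE] := extend_along_injection (@rr_in Om) lam.
exists mu; rewrite !sum_imfset //; split.
- by move=> _ /imfsetP[v /= vO ->]; rewrite muE // l0.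
- by rewrite -l1; apply: eq_big_seq => v vO; rewrite muE.
- by rewrite lx; apply: eq_big_seq => v vO; rewrite muE.
Qed.

Lemma simplex_affine Om lam : affinely_independent (simplex R Om) ->
  \sum_(v <- Om) lam v = 0 -> \sum_(v <- Om) lam v *: rr v = 0 ->
  forall v, v \in Om -> lam v = 0.
Proof.
move=> aff s0 l0 v vO; have [mu muE] := extend_along_injection (@rr_in Om) lam.
rewrite -muE //; apply: (aff mu); last by rewrite in_imfset.
- by rewrite sum_imfset // -[RHS]s0; apply: eq_big_seq => w wO; rewrite muE.
- by rewrite sum_imfset // -[RHS]l0; apply: eq_big_seq => w wO; rewrite muE.
Qed.

End Simplices.

Section Triangulation.
Variables (R : realType) (d : nat) (A : {fset 'rV[R]_d}).
Variable T : {fset {fset 'rV[rat]_d}}.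
Let P := conv A.
Hypothesis P0 : interior P 0.
Hypothesis triT : boundary_triangulation P T.
Implicit Types (Om Phi Psi : {fset 'rV[rat]_d}) (lam : 'rV[rat]_d -> R).
Local Notation rr := (@rat_to_real R d).

Let PO : P 0.
Proof. exact: interior_subset. Qed.

Lemma simplex_boundary Om x : Om \in T -> conv (simplex R Om) x -> boundary P x.
Proof. by case: triT => _ _ _ _ <- OT Ox; exists Om. Qed.

Lemma cone_boundary Om lam : Om \in T -> (forall v, v \in Om -> 0 <= lam v) ->
  0 < \sum_(v <- Om) lam v ->
  boundary P ((\sum_(v <- Om) lam v)^-1 *: \sum_(v <- Om) lam v *: rr v).
Proof.
move=> OT l0 s0; apply: (simplex_boundary OT); apply/conv_simplexP.
exists (fun v => (\sum_(w <- Om) lam w)^-1 * lam v); split.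
- by move=> v vO; rewrite mulr_ge0 ?l0 // invr_ge0 ltW.
- by rewrite -mulr_sumr mulVf // gt_eqF.
- by rewrite scaler_sumr; apply: eq_bigr => v _; rewrite scalerA.
Qed.

Lemma vertex_in_polytope Om v : Om \in T -> v \in Om -> P (rr v).
Proof.
move=> OT vO; apply: boundary_conv; apply: (simplex_boundary OT).
by apply: conv_gen; rewrite in_imfset.
Qed.

(* If the affine hull of a boundary simplex contained 0, its barycentre could be
   pushed radially outwards inside the simplex. *)
Lemma simplex_linearly_independent Om :
  Om \in T -> linearly_independent Om rr.
Proof.
move=> OT c c0; set C := \sum_(v <- Om) c v.
have [C0|C0] := eqVneq C 0.
  by apply: simplex_affine C0 c0; case: triT => _ + _ _ _; apply.
exfalso; set n := #|` Om|; have n0 : (0 < n)%N.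
  rewrite lt0n cardfs_eq0; apply: contra C0 => /eqP O0.
  by rewrite /C O0 big_seq_fset0.
have nR : (0 : R) < n%:R by rewrite ltr0n.
have [b bP] := @seq_upper_bound _ _ Om (fun v => c v / C).
(* Since [c v / C] is at most [|b| + 1], this choice bounds [e * (c v / C)] by the barycentric
   weight [1/n], so the perturbed weights below stay nonnegative. *)
pose e := (n%:R * (`|b| + 1))^-1.
have b1 : 0 < `|b| + 1 by rewrite ltr_wpDl.
have e0 : 0 < e by rewrite invr_gt0 mulr_gt0.
have sn (k : R) : \sum_(v <- Om) k = n%:R * k.
  by rewrite big_const_seq count_predT iter_addr_0 mulr_natl.
have bdy (l : 'rV[rat]_d -> R) : (forall v, v \in Om -> 0 <= l v) ->
    \sum_(v <- Om) l v = 1 -> boundary P (\sum_(v <- Om) l v *: rr v).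
  by move=> l0 l1; have := cone_boundary OT l0; rewrite l1 ltr01 invr1 scale1r => /(_ isT).
have B1 : boundary P (\sum_(v <- Om) n%:R^-1 *: rr v).
  apply: (bdy (fun=> n%:R^-1)); last by rewrite sn mulfV // gt_eqF.
  by move=> v _; rewrite invr_ge0 ltW.
(* Subtracting [e / C] times the null combination leaves the point unchanged and lowers the sum of
   its weights from [1 + e] to 1, which places it in the simplex. *)
have B2 : boundary P ((1 + e) *: \sum_(v <- Om) n%:R^-1 *: rr v).
  have -> : (1 + e) *: \sum_(v <- Om) n%:R^-1 *: rr v =
      \sum_(v <- Om) ((1 + e) / n%:R - e * (c v / C)) *: rr v.
    under [RHS]eq_bigr do rewrite scalerBl.
    rewrite sumrB [X in _ = _ - X](_ : _ = (e / C) *: \sum_(v <- Om) c v *: rr v).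
      rewrite c0 scaler0 subr0 scaler_sumr; apply: eq_bigr => v _.
      by rewrite scalerA.
    rewrite scaler_sumr; apply: eq_bigr => v _; rewrite scalerA.
    by congr (_ *: _); ring.
  apply: bdy; last first.
    rewrite sumrB sn -mulr_sumr -mulr_suml -/C divff // mulr1 mulrC divfK ?gt_eqF //.
    by rewrite addrK.
  move=> v vO; have h : c v / C <= `|b| + 1.
    apply: le_trans (ltW (bP v vO)) _; apply: le_trans (ler_norm b) _.
    by rewrite lerDl ler01.
  rewrite subr_ge0; apply: le_trans (_ : e * (`|b| + 1) <= _).
    by rewrite ler_pM2l.
  have -> : e * (`|b| + 1) = n%:R^-1 by rewrite /e invfM -mulrA mulVf ?mulr1 ?gt_eqF.
  by rewrite mulrDl mul1r lerDl divr_ge0 // ltW.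
have := boundary_radial P0 B1 (boundary_conv B2); lra.
Qed.

Lemma simplex_card_le Om : Om \in T -> (#|` Om| <= d)%N.
Proof. by move=> OT; exact: (indep_card_le 0 (simplex_linearly_independent OT)). Qed.

Lemma cone_cover x : exists Om lam, [/\ Om \in T,
  forall v, v \in Om -> 0 < lam v & x = \sum_(v <- Om) lam v *: rr v].
Proof.
have [->|x0] := eqVneq x 0.
  exists fset0, (fun=> 0); split; rewrite ?big_seq_fset0 //; by case: triT.
have [s s0 bs] := boundary_ray P0 x0.
case: triT => _ _ sub _ cover; move: bs; rewrite -cover.
move=> [Om /= OT /conv_simplexP[lam [l0 l1 lx]]].
(* Discarding the zero weights passes to the face whose relatively open cone contains [x]. *)
exists [fset v in Om | 0 < lam v]%fset, (fun v => s^-1 * lam v); split.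
- by apply: (sub Om) => //; apply: fset_sub.
- by move=> v; rewrite !inE /= => /andP[_ lv]; rewrite mulr_gt0 ?invr_gt0.
rewrite (_ : x = s^-1 *: (s *: x)); last by rewrite scalerA mulVf ?scale1r ?gt_eqF.
rewrite lx scaler_sumr; under [RHS]eq_bigr do rewrite -scalerA.
apply/esym/big_fset_incl; first exact: fset_sub.
move=> v vO; rewrite !inE vO /= -leNgt => lv.
have -> : lam v = 0 by apply/eqP; rewrite eq_le lv l0.
by rewrite scale0r scaler0.
Qed.

(** The weight sum is the gauge of [P]: dividing the point by it gives a boundary point, and [P]
    ends there along the ray. *)
Lemma cone_dilate Om lam (t : R) : Om \in T ->
  (forall v, v \in Om -> 0 <= lam v) -> 0 <= t ->
  [set t *: y | y in P] (\sum_(v <- Om) lam v *: rr v) <->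
  \sum_(v <- Om) lam v <= t.
Proof.
move=> OT l0 t0; set s := \sum_(v <- Om) lam v; set x := \sum_(v <- Om) _.
have : 0 <= s by rewrite /s big_seq sumr_ge0.
rewrite le_eqVlt => /orP[/eqP s0|s0].
  rewrite -s0; split=> // _; exists 0 => //; rewrite scaler0 /x big_seq big1 // => v vO.
  suff -> : lam v = 0 by rewrite scale0r.
  have : s == 0 by rewrite -s0.
  rewrite /s big_seq psumr_eq0 // => /allP/(_ v vO).
  by rewrite vO => /eqP.
have := cone_boundary OT l0 s0; rewrite -/s -/x; set c := s^-1 *: x => bc.
have xc : x = s *: c by rewrite scalerA mulfV ?scale1r ?gt_eqF.
split=> [[y Py yx]|st].
  move: t0; rewrite le_eqVlt => /orP[/eqP t0|t0].
    have x0 : x = 0 by rewrite -yx -t0 scale0r.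
    (* Here the boundary point [c] would be 0, and every multiple of it lies in [P]; any factor
       above 1 gives the contradiction. *)
    have := @boundary_radial _ _ _ P0 c 2 bc; rewrite /c x0 !scaler0 => /(_ PO).
    by rewrite leNgt ltr1n.
  have : P ((s / t) *: c).
    have -> : (s / t) *: c = y; last by [].
    by rewrite mulrC -scalerA -xc -yx scalerA mulVf ?scale1r ?gt_eqF.
  by move=> /(boundary_radial P0 bc); rewrite ler_pdivrMr // mul1r.
have t1 : 0 < t by apply: lt_le_trans st.
exists ((s / t) *: c); last first.
  by rewrite scalerA xc; congr (_ *: _); field; rewrite gt_eqF.
apply: conv_star => //; last exact: boundary_conv.
by rewrite (divr_ge0 (ltW s0) (ltW t1)) /= ler_pdivrMr // mul1r.
Qed.

(** A vertex missing from [Psi] would have a positive coefficient on one side and 0 on the other,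
    against linear independence. *)
Lemma face_coordinates Om Psi lam (nu : 'rV[rat]_d -> R) : Om \in T ->
  (Psi `<=` Om)%fset -> (forall v, v \in Om -> 0 < lam v) ->
  \sum_(v <- Om) lam v *: rr v = \sum_(v <- Psi) nu v *: rr v -> Psi = Om.
Proof.
move=> OT PO' l0 eq_x; apply/eqP; rewrite eqEfsubset PO' /=; apply/fsubsetP => v vO.
apply: contraT => vN.
have := simplex_linearly_independent OT
  (lam := fun v => lam v - (if v \in Psi then nu v else 0)).
move=> /(_ _ v vO); rewrite (negPf vN) subr0 => lv.
suff /lv lv0 : \sum_(v <- Om) (lam v - (if v \in Psi then nu v else 0)) *: rr v = 0.
  by have := l0 v vO; rewrite lv0 ltxx.
under eq_bigr do rewrite scalerBl.
rewrite sumrB eq_x; apply/eqP; rewrite subr_eq0; apply/eqP.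
rewrite -(big_fset_incl _ PO'); first by apply: eq_big_seq => w ->.
by move=> w _ /negPf ->; rewrite scale0r.
Qed.

(** By [cone_dilate] both weight sums are the same gauge value. Dividing by it puts the point into
    both simplices, hence into a common face, which by [face_coordinates] is all of each. *)
Lemma cone_unique Om Phi lam (mu : 'rV[rat]_d -> R) : Om \in T -> Phi \in T ->
  (forall v, v \in Om -> 0 < lam v) -> (forall v, v \in Phi -> 0 < mu v) ->
  \sum_(v <- Om) lam v *: rr v = \sum_(v <- Phi) mu v *: rr v -> Om = Phi.
Proof.
move=> OT FT l0 m0 eq_x.
have l0' v : v \in Om -> 0 <= lam v by move=> /l0/ltW.
have m0' v : v \in Phi -> 0 <= mu v by move=> /m0/ltW.
set s := \sum_(v <- Om) lam v; have s0 : 0 <= s by rewrite /s big_seq sumr_ge0.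
set r := \sum_(v <- Phi) mu v; have r0 : 0 <= r by rewrite /r big_seq sumr_ge0.
have sr : s = r.
  apply/eqP; rewrite eq_le; apply/andP; split.
    by apply/(cone_dilate OT l0' r0); rewrite eq_x; apply/cone_dilate.
  by apply/(cone_dilate FT m0' s0); rewrite -eq_x; apply/cone_dilate.
have triv Psi (nu : 'rV[rat]_d -> R) : (forall v, v \in Psi -> 0 < nu v) ->
    \sum_(v <- Psi) nu v = 0 -> Psi = fset0.
  move=> n0 /eqP; rewrite big_seq psumr_eq0; last by move=> v /n0/ltW.
  move=> /allP nu0; apply/fsetP => v; rewrite inE; apply/negbTE/negP => vP.
  by have := nu0 v vP; rewrite vP /= => /eqP h; have := n0 v vP; rewrite h ltxx.
move: s0; rewrite le_eqVlt => /orP[/eqP s0|s0].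
  by rewrite (triv Om lam l0 (esym s0)) (triv Phi mu m0) // -/r -sr -s0.
case: (triT) => _ _ _ /(_ Om Phi OT FT)[Psi [PsO PsF cap]] _.
have : conv (simplex R Psi) (s^-1 *: \sum_(v <- Om) lam v *: rr v).
  rewrite -cap; split; apply/conv_simplexP.
    exists (fun v => s^-1 * lam v); split.
    - by move=> v vO; rewrite mulr_ge0 ?l0' // invr_ge0 ltW.
    - by rewrite -mulr_sumr mulVf // gt_eqF.
    - by rewrite scaler_sumr; apply: eq_bigr => v _; rewrite scalerA.
  exists (fun v => s^-1 * mu v); split.
  - by move=> v vO; rewrite mulr_ge0 ?m0' // invr_ge0 ltW.
  - by rewrite -mulr_sumr -/r -sr mulVf // gt_eqF.
  - by rewrite eq_x scaler_sumr; apply: eq_bigr => v _; rewrite scalerA.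
move=> /conv_simplexP[nu [_ _ xnu]].
have xE : \sum_(v <- Om) lam v *: rr v = \sum_(v <- Psi) (s * nu v) *: rr v.
  under [RHS]eq_bigr do rewrite -scalerA.
  by rewrite -scaler_sumr -xnu scalerA mulfV ?scale1r ?gt_eqF.
rewrite -(face_coordinates OT PsO l0 xE).
by apply: face_coordinates FT PsF m0 _; rewrite -eq_x xE.
Qed.

(* A point in no top-dimensional cone could be perturbed along the moment curve
   to a point outside every cone. *)
Lemma facet_cone_cover x : exists Om lam, [/\ Om \in T, #|` Om| = d,
  forall v, v \in Om -> 0 <= lam v & x = \sum_(v <- Om) lam v *: rr v].
Proof.
apply: contrapT => xN.
(* Along the moment curve, the value of [f] is the polynomial [p f], whose coefficients beyond the
   constant one are the coordinates of [f]; so it is nonzero for [f != 0]. *)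
pose m (t : R) : 'rV[R]_d := \row_i t ^+ i.+1.
pose p f := (dot x f)%:P + \sum_(i < d) f 0 i *: 'X^(i.+1).
have pE f t : (p f).[t] = dot (x + m t) f.
  rewrite dotDl hornerD hornerC horner_sum; congr (_ + _); apply: eq_bigr => i _.
  by rewrite hornerZ hornerXn mxE mulrC.
have p0 f : f != 0 -> p f != 0.
  apply: contra => /eqP/polyP pf; apply/eqP/rowP => i; rewrite mxE.
  have := pf i.+1; rewrite coefD coefC coef0 /= add0r coef_sum (bigD1 i) //=.
  rewrite coefZ coefXn eqxx mulr1 big1 ?addr0 // => j ji.
  by rewrite coefZ coefXn eqSS eq_sym (inj_eq val_inj) (negPf ji) mulr0.
(* Each cone gets a functional that is nonnegative on it and negative at [x + m t] for all small
   [t > 0]; finitely many cones then share one [t]. *)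
have [|t t0 H] := @seq_eventually R _ T (fun Om t => exists2 f,
    forall v, v \in Om -> 0 <= dot (rr v) f & dot (x + m t) f < 0).
  move=> Om OT; have indep := simplex_linearly_independent OT.
  have := simplex_card_le OT; rewrite leq_eqVlt => /orP[/eqP Od|Od].
    have [lam xl] := indep_spanning 0 indep Od x.
    have [v vO lv] : exists2 v, v \in Om & lam v < 0.
      apply: contrapT => H; apply: xN; exists Om, lam; split=> // v vO.
      by rewrite leNgt; apply/negP => lv; apply: H; exists v.
    (* This [f] reads off the coordinate at [v], which is negative already at [t = 0]. *)
    have [f fO] := indep_interpolation 0 indep (fun w => (w == v)%:R).
    have [|e e0 eP] := @poly_neg_near0 R (p f).
      rewrite pE dotDl (_ : m 0 = 0) ?dot0l ?addr0; last first.
        by apply/rowP => i; rewrite !mxE expr0n.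
      rewrite xl dot_lincomb (big_fsetD1 v) //= fO // eqxx mulr1.
      rewrite big_seq big1 ?addr0 // => w; rewrite !inE => /andP[wv wO].
      by rewrite fO // (negPf wv) mulr0.
    exists e => // t /eP; rewrite pE => pt; exists f => // w wO.
    by rewrite fO // ler0n.
  (* On a cone of smaller dimension [f] vanishes, so whichever sign [p f] takes near 0, one of [f]
     and [- f] works. *)
  have [f f0 fO] := indep_annihilator 0 indep Od.
  have [e e0 [eP|eP]] := poly_sign_near0 (p0 f f0); exists e => // t /eP; rewrite pE => pt.
    by exists f => // v vO; rewrite fO.
  exists (- f); first by move=> v vO; rewrite -scaleN1r dotZr fO // mulr0.
  by rewrite -scaleN1r dotZr mulN1r oppr_lt0.
have [Om [lam [OT l0 xl]]] := cone_cover (x + m t).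
have [f f0] := H Om OT; rewrite xl dot_lincomb ltNge big_seq sumr_ge0 // => v vO.
by rewrite mulr_ge0 ?f0 // ltW ?l0.
Qed.

(** If the value at [x] exceeded 1, a small amount of [x] mixed with a suitable point of the simplex
    would give [(1 + e) *: c], beyond the barycentre [c], although [c] is on the boundary. *)
Lemma facet_functional_le1 Om y : Om \in T -> #|` Om| = d ->
  (forall v, v \in Om -> dot (rr v) y = 1) -> forall x, P x -> dot x y <= 1.
Proof.
move=> OT Od Oy x Px.
have [xi xE] := indep_spanning 0 (simplex_linearly_independent OT) Od x.
have -> : dot x y = \sum_(v <- Om) xi v.
  by rewrite xE dot_lincomb; apply: eq_big_seq => v vO; rewrite Oy ?mulr1.
set X := \sum_(v <- Om) xi v; rewrite leNgt; apply/negP => X1.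
set n := #|` Om|; have n0 : (0 < n)%N.
  rewrite lt0n cardfs_eq0; apply: contraTneq X1 => O0.
  by rewrite -leNgt /X O0 big_seq_fset0 ler01.
have nR : (1 : R) <= n%:R by rewrite ler1n.
have nR0 : (0 : R) < n%:R by rewrite ltr0n.
have [b bP] := @seq_upper_bound _ _ Om xi.
(* The product of [D] and [|b| + 2] is [1/n], which keeps the weights [(1 + e)/n - D * xi v]
   nonnegative; the [+ 2] also forces [D < 1]. With [e = D * (X - 1)] these weights sum to
   [1 - D]. *)
pose D := (n%:R * (`|b| + 2))^-1; have b0 := normr_ge0 b.
have D0 : 0 < D by rewrite invr_gt0 mulr_gt0 //; lra.
have Dn : D * (`|b| + 2) = n%:R^-1.
  by rewrite /D invfM -mulrA mulVf ?mulr1 // gt_eqF //; lra.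
have D1 : D < 1.
  rewrite invf_lt1 ?mulr_gt0 //; last by lra.
  by have := ler_pM ler01 (ler0n _ 2) nR (_ : 2 <= `|b| + 2); lra.
pose e := D * (X - 1); have e0 : 0 < e by rewrite mulr_gt0 // subr_gt0.
have sn (k : R) : \sum_(v <- Om) k = n%:R * k.
  by rewrite big_const_seq count_predT iter_addr_0 mulr_natl.
pose c : 'rV[R]_d := \sum_(v <- Om) n%:R^-1 *: rr v.
have bc : boundary P c.
  have := @cone_boundary _ (fun=> n%:R^-1) OT.
  rewrite sn mulfV ?gt_eqF // ltr01 invr1 scale1r; apply => // v _.
  by rewrite invr_ge0 ltW.
suff /(boundary_radial P0 bc) : P ((1 + e) *: c) by lra.
have -> : (1 + e) *: c = D *: x + (1 - D) *: ((1 - D)^-1 *: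
    \sum_(v <- Om) ((1 + e) / n%:R - D * xi v) *: rr v).
  rewrite scalerA mulfV ?scale1r; last by rewrite subr_eq0 gt_eqF.
  rewrite xE !scaler_sumr -big_split /=; apply: eq_bigr => v _.
  by rewrite !scalerA -scalerDl; congr (_ *: _); ring.
have sE : \sum_(v <- Om) ((1 + e) / n%:R - D * xi v) = 1 - D.
  rewrite sumrB sn -mulr_sumr -/X mulrC divfK ?gt_eqF // /e; ring.
apply: conv_convex => //; first by rewrite !ltW.
rewrite -sE; apply/boundary_conv/cone_boundary; rewrite ?sE ?subr_gt0 // => v vO.
rewrite subr_ge0; apply: le_trans (_ : D * (`|b| + 2) <= _).
  rewrite ler_pM2l //; have := bP v vO; have := ler_norm b; lra.
by rewrite Dn mulrDl mul1r lerDl divr_ge0 // ltW.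
Qed.

(** The half of the bipolar theorem that needs separation: the separating functional is positive at
    [x] because 0 lies in [P], and is divided by a positive level that bounds it on [P] but not at
    [x]. *)
Lemma bidual x : (forall y, dual P y -> dot x y <= 1) -> P x.
Proof.
move=> xP; apply: contrapT => /conv_separation[f fA].
have f0 : 0 < dot x f.
  have [t tx tA] := seq_strict_bound fA.
  have h : dot 0 f <= t by apply: (@conv_dot_le _ _ A) PO => a /tA/ltW.
  by rewrite dot0l in h; lra.
have [t tx tA] := seq_strict_bound fA.
pose t' := Num.max t (dot x f / 2).
have t'x : t' < dot x f by rewrite gt_max tx /=; lra.
have t'0 : 0 < t' by rewrite lt_max; apply/orP; right; lra.
have : dot x (t'^-1 *: f) <= 1.
  apply: xP => z Pz; rewrite -/(dot z (t'^-1 *: f)) dotZr mulrC ler_pdivrMr // mul1r.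
  apply: (@conv_dot_le _ _ A) Pz => a /tA/ltW at'.
  by rewrite le_max at'.
by rewrite dotZr mulrC ler_pdivrMr // mul1r leNgt t'x.
Qed.

(** No gauge function is introduced: by [cone_unique] and linear independence a point has only one
    such representation, so quantifying over representations amounts to evaluating [s(x)]. *)
Definition integral_gauge := forall (x : 'rV[int]_d) Om lam, Om \in T ->
  (forall v, v \in Om -> 0 < lam v) ->
  int_to_real R x = \sum_(v <- Om) lam v *: rr v ->
  \sum_(v <- Om) lam v \is a Num.int.

Lemma dot_int (x y : 'rV[int]_d) :
  dot (int_to_real R x) (int_to_real R y) \is a Num.int.
Proof. by apply: rpred_sum => i _; rewrite !mxE rpredM ?intr_int. Qed.

(** At the boundary point [c = x / s] some lattice generator of the dual attains the value 1, so [s]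
    is an integer dot product. Otherwise all generators stay below some [t' < 1] at [c], and
    [c / t'] would lie in the bidual, hence in [P]. *)
Lemma lattice_dual_integral_gauge :
  lattice_polytope (dual P) -> integral_gauge.
Proof.
move=> [Y dY] x Om lam OT l0 xE; set s := \sum_(v <- Om) lam v.
have l0' v : v \in Om -> 0 <= lam v by move=> /l0/ltW.
have : 0 <= s by rewrite /s big_seq sumr_ge0.
rewrite le_eqVlt => /orP[/eqP <-|s0]; first exact: rpred0.
have := cone_boundary OT l0' s0; rewrite -/s -xE; set c := s^-1 *: _ => bc.
set Z := [fset _ | _ in Y]%fset in dY.
have cZ z : z \in Z -> dot c z <= 1.
  move=> zZ; have : dual P z by rewrite dY; apply: conv_gen.
  by apply; apply: boundary_conv.
suff [z zZ cz] : exists2 z, z \in Z & dot c z = 1.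
  move/imfsetP: zZ => [y /= yY zE].
  suff -> : s = dot (int_to_real R x) (int_to_real R y) by apply: dot_int.
  rewrite -[int_to_real R x](_ : s *: c = _); last first.
    by rewrite /c scalerA mulfV ?scale1r ?gt_eqF.
  by rewrite -zE dotZl cz mulr1.
apply: contrapT => noz.
have [z zZ|t t1 tZ] := @seq_strict_bound _ _ Z (dot c) 1.
  by rewrite lt_neqAle cZ // andbT; apply/eqP => cz; apply: noz; exists z.
pose t' := Num.max t (1 / 2).
have t'1 : t' < 1 by rewrite gt_max t1 /=; lra.
have t'0 : 0 < t' by rewrite lt_max; apply/orP; right; lra.
have : P (t'^-1 *: c).
  apply: bidual => y; rewrite dY => Zy.
  rewrite dotZl mulrC ler_pdivrMr // mul1r dotC.
  apply: (@conv_dot_le _ _ Z) Zy => z zZ; rewrite dotC le_max.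
  by rewrite ltW // tZ.
by move=> /(boundary_radial P0 bc); rewrite invf_le1 // leNgt t'1.
Qed.

Section IntegralGauge.
Hypothesis gaugeZ : integral_gauge.
Variable q : nat.
Hypothesis q_gt0 : (0 < q)%N.
Hypothesis qT : forall Om v, Om \in T -> v \in Om ->
  exists r : 'rV[int]_d, int_to_real R r = q%:R *: rr v.

(** Coordinate [i] of [y] is its value at a unit vector, which may lie outside the cone of [Om],
    where the gauge need not agree with [y]. Adding a large multiple [N] of the lattice point [r],
    the sum of all [q v], moves it into the open cone and changes the value by an integer. *)
Lemma facet_functional_integral Om : Om \in T -> #|` Om| = d ->
  exists y : 'rV[int]_d, forall v, v \in Om -> dot (rr v) (int_to_real R y) = 1.
Proof.
move=> OT Od; have indep := simplex_linearly_independent OT.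
have [y yO] := indep_interpolation 0 indep (fun=> 1).
have rP (s : seq 'rV[rat]_d) : {subset s <= Om} ->
    exists r : 'rV[int]_d, int_to_real R r = \sum_(v <- s) q%:R *: rr v.
  elim: s => [|v s IH] sO.
    by exists 0; rewrite big_nil; apply/rowP => i; rewrite !mxE.
  have [|r rE] := IH; first by move=> w ws; apply: sO; rewrite inE ws orbT.
  have [r' r'E] := qT OT (sO v (mem_head _ _)).
  exists (r' + r); rewrite big_cons -rE -r'E.
  by apply/rowP => i; rewrite !mxE intrD.
have [r rE] := rP _ (fun v => id).
have yint i : y 0 i \is a Num.int.
  pose e : 'rV[int]_d := delta_mx 0 i.
  have [xi xiE] := indep_spanning 0 indep Od (int_to_real R e).
  have [b bP] := @seq_upper_bound _ _ Om (fun v => - xi v).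
  pose N := Num.bound `|b|; have bN : b < N%:R.
    by apply: le_lt_trans (ler_norm b) _; apply: archi_boundP.
  have yi : y 0 i = \sum_(v <- Om) xi v.
    transitivity (dot (int_to_real R e) y).
      rewrite /dot (bigD1 i) //= !mxE !eqxx mul1r big1 ?addr0 // => j ji.
      by rewrite !mxE eqxx /= (negPf ji) mul0r.
    by rewrite xiE dot_lincomb; apply: eq_big_seq => v vO; rewrite yO ?mulr1.
  have := gaugeZ (x := r *+ N + e) (lam := fun v => N%:R * q%:R + xi v) OT.
  have -> : \sum_(v <- Om) (N%:R * q%:R + xi v) = (N * q * #|` Om|)%:R + y 0 i.
    rewrite big_split /= -yi big_const_seq count_predT iter_addr_0; congr (_ + _).
    by rewrite -natrM -mulrnA.
  rewrite rpredDl ?rpred_nat //; apply.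
    move=> v vO; have := bP v vO.
    have : (N%:R : R) <= N%:R * q%:R by rewrite ler_peMr // ler1n.
    by lra.
  have -> : int_to_real R (r *+ N + e) = N%:R *: int_to_real R r + int_to_real R e.
    by apply/rowP => j; rewrite !mxE intrD mulmxnE rmorphMn /= mulr_natl.
  rewrite rE xiE scaler_sumr -big_split /=; apply: eq_bigr => v _.
  by rewrite scalerA -scalerDl.
exists (\row_i Num.floor (y 0 i)) => v vO; rewrite -(yO v vO); congr dot.
by apply/rowP => i; rewrite !mxE; apply/eqP; rewrite -intrEfloor.
Qed.

(** A point [z] of the dual outside the hull of the facet functionals is separated from it by a
    direction [x]. But [x] lies in a closed facet cone, and there the functional of that facet
    dominates [z], since it has value 1 at the vertices, where [z] has value at most 1. *)
Lemma integral_gauge_lattice_dual : lattice_polytope (dual P).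
Proof.
pose F := [fset Om in T | #|` Om| == d]%fset.
have [y yP] : exists y : {fset 'rV[rat]_d} -> 'rV[int]_d, forall Om, Om \in F ->
    forall v, v \in Om -> dot (rr v) (int_to_real R (y Om)) = 1.
  suff /boolp.choice[y yP] : forall Om, exists y : 'rV[int]_d, Om \in F ->
      forall v, v \in Om -> dot (rr v) (int_to_real R y) = 1 by exists y.
  move=> Om.
  have [|OF] := boolP (Om \in F); last by exists 0.
  rewrite !inE /= => /andP[OT /eqP Od].
  by have [y yO] := facet_functional_integral OT Od; exists y.
exists [fset y Om | Om in F]%fset; apply/seteqP; split => z.
  move=> Pz; apply: contrapT => /conv_separation[x xY].
  have [Om [lam [OT Od l0 xE]]] := facet_cone_cover x.
  have OF : Om \in F by rewrite !inE OT Od eqxx.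
  have /xY : int_to_real R (y Om) \in
      [fset int_to_real R v | v in [fset y Om | Om in F]%fset]%fset.
    by apply/imfsetP; exists (y Om) => //=; apply/imfsetP; exists Om.
  rewrite ltNge => /negP; apply; rewrite !(dotC _ x) xE !dot_lincomb !big_seq.
  apply: ler_sum => v vO; rewrite yP // ler_wpM2l ?l0 //.
  by apply: Pz; apply: vertex_in_polytope vO.
move=> zY x Px; rewrite -/(dot x z) dotC.
apply: conv_dot_le zY => _ /imfsetP[_ /= /imfsetP[Om /= OF ->] ->].
rewrite dotC; move: (OF); rewrite !inE /= => /andP[OT /eqP Od].
by apply: (facet_functional_le1 OT Od) Px; apply: yP.
Qed.

End IntegralGauge.
End Triangulation.

(** * Rational power series *)

Section PowerSeries.
Implicit Types (D E N p : {poly rat}) (f g : nat -> rat) (F G : ratfun).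

(* The coefficients of the product of D with the power series sum_n f n z^n. *)
Definition act D f (n : nat) : rat := \sum_(k < n.+1) D`_k * f (n - k)%N.

Lemma act_trunc D f m n : (n < m)%N -> act D f n = (D * \poly_(i < m) f i)`_n.
Proof.
move=> nm; rewrite coefM; apply: eq_bigr => k _; rewrite coef_poly.
by rewrite (leq_ltn_trans _ nm) // leq_subr.
Qed.

Lemma act_coef D p n : act D (fun i => p`_i) n = (D * p)`_n.
Proof. by rewrite coefM. Qed.

Lemma eq_act D f g n : f =1 g -> act D f n = act D g n.
Proof. by move=> fg; apply: eq_bigr => k _; rewrite fg. Qed.

Lemma actM D E f n : act (D * E) f n = act D (act E f) n.
Proof.
rewrite (act_trunc _ _ (ltnSn n)) -mulrA coefM; apply: eq_bigr => k _.
by rewrite (@act_trunc _ _ n.+1) // ltnS leq_subr.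
Qed.

Lemma actDl D E f n : act (D + E) f n = act D f n + act E f n.
Proof. by rewrite -big_split; apply: eq_bigr => k _; rewrite coefD mulrDl. Qed.

Lemma actDr D f g n : act D (fun i => f i + g i) n = act D f n + act D g n.
Proof. by rewrite -big_split; apply: eq_bigr => k _; rewrite mulrDr. Qed.

(** A series with nonzero constant term is invertible; strong induction recovers the coefficients
    one by one. *)
Lemma act_inj D f g : D`_0 != 0 -> act D f =1 act D g -> f =1 g.
Proof.
move=> D0 fg n; elim/ltn_ind: n => n IH.
have := fg n; rewrite /act !big_ord_recl subn0 /= => eqn.
apply: (mulfI D0); apply: (addIr (\sum_(i < n) D`_(bump 0 i) * f (n - bump 0 i)%N)).
rewrite eqn; congr (_ + _); apply: eq_bigr => i _; rewrite IH //.
by rewrite /bump /= ltn_subrL /= (leq_ltn_trans _ (ltn_ord i)).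
Qed.

Lemma act_Xn q f n : act 'X^q f n = if (q <= n)%N then f (n - q)%N else 0.
Proof.
case: leqP => qn.
  rewrite /act (bigD1 (Ordinal (qn : (q < n.+1)%N))) //= coefXn eqxx mul1r.
  rewrite big1 ?addr0 // => k kq; rewrite coefXn; case: eqP; rewrite ?mul0r // => kE.
  by rewrite -val_eqE /= kE eqxx in kq.
rewrite /act big1 // => k _; rewrite coefXn; case: eqP; rewrite ?mul0r // => kE.
by have := ltn_ord k; rewrite kE ltnS leqNgt qn.
Qed.

Lemma act_1subXn q f n : act (1 - 'X^q) f n = f n - act 'X^q f n.
Proof.
rewrite -[1](expr0 'X).
have := actDl ('X^0 - 'X^q) 'X^q f n; rewrite subrK (act_Xn 0) /= subn0 => ->.
by rewrite addrK.
Qed.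

(** This says that [f] is the power series expansion of [F]: one denominator [D] clears both to the
    same polynomial. As its constant term is nonzero, [D] is invertible as a series and in the
    field, so [f] and [F] determine each other. *)
Definition is_gf f F := exists N D, [/\ D`_0 != 0,
  polyF D * F = polyF N & forall n, act D f n = N`_n].

Lemma polyFM D E : polyF (D * E) = polyF D * polyF E.
Proof. exact: tofracM. Qed.

Lemma polyFD D E : polyF (D + E) = polyF D + polyF E.
Proof. exact: tofracD. Qed.

Lemma polyF_inj : injective polyF.
Proof. by move=> p r /eqP; rewrite tofrac_eq => /eqP. Qed.

Lemma polyF0 : polyF 0 = 0.
Proof. exact: tofrac0. Qed.

Lemma polyF_eq0 p : (polyF p == 0) = (p == 0).
Proof. exact: tofrac_eq0. Qed.

Lemma coef0_neq0 D : D`_0 != 0 -> D != 0.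
Proof. by apply: contraNneq => ->; rewrite coef0. Qed.

Lemma coef0M_neq0 D E : D`_0 != 0 -> E`_0 != 0 -> (D * E)`_0 != 0.
Proof. by move=> D0 E0; rewrite coefM big_ord1 mulf_neq0. Qed.

Lemma gf_ext f g F : f =1 g -> is_gf f F -> is_gf g F.
Proof.
move=> fg [N [D [D0 DF Df]]]; exists N, D; split=> // n.
by rewrite -Df; apply: eq_act => i; rewrite fg.
Qed.

Lemma gf_coef p : is_gf (fun n => p`_n) (polyF p).
Proof.
exists p, 1; split; first by rewrite coef1 oner_neq0.
  by rewrite -polyFM mul1r.
by move=> n; rewrite act_coef mul1r.
Qed.

Lemma gf_act p f F : is_gf f F -> is_gf (act p f) (polyF p * F).
Proof.
move=> [N [D [D0 DF Df]]]; exists (p * N), D; split=> //.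
  by rewrite mulrCA DF polyFM.
by move=> n; rewrite -actM mulrC actM -act_coef; apply: eq_act.
Qed.

Lemma gfD f g F G : is_gf f F -> is_gf g G -> is_gf (fun n => f n + g n) (F + G).
Proof.
move=> [N [D [D0 DF Df]]] [M [E [E0 EG Eg]]].
exists (E * N + D * M), (D * E); split; first exact: coef0M_neq0.
  by rewrite polyFD !polyFM mulrDr -DF -EG; ring.
move=> n; rewrite actDr coefD; congr (_ + _).
  by rewrite mulrC actM -act_coef; apply: eq_act.
by rewrite actM -act_coef; apply: eq_act.
Qed.

Lemma gf_sum (I : eqType) (s : seq I) (f : I -> nat -> rat) (F : I -> ratfun) :
  (forall i, i \in s -> is_gf (f i) (F i)) ->
  is_gf (fun n => \sum_(i <- s) f i n) (\sum_(i <- s) F i).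
Proof.
elim: s => [|i s IH] H.
  rewrite big_nil -polyF0; apply: gf_ext (gf_coef 0) => n.
  by rewrite coef0 big_nil.
rewrite big_cons; apply: gf_ext (gfD (H i (mem_head _ _)) (IH _)).
  by move=> n; rewrite big_cons.
by move=> j js; apply: H; rewrite inE js orbT.
Qed.

Lemma gf_div p f G : p`_0 != 0 -> is_gf (act p f) G -> is_gf f (G / polyF p).
Proof.
move=> p0 [N [D [D0 DG Df]]]; exists N, (D * p); split; first exact: coef0M_neq0.
  by rewrite polyFM mulrACA mulfV ?mulr1 // polyF_eq0 coef0_neq0.
by move=> n; rewrite actM.
Qed.

Lemma gf_polyP f p : is_gf f (polyF p) -> forall n, f n = p`_n.
Proof.
move=> [N [D [D0 DF Df]]]; apply: (act_inj D0) => n.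
by rewrite Df act_coef; move: DF; rewrite -polyFM => /polyF_inj ->.
Qed.

Lemma gf_eq0 f F : is_gf f F -> F = 0 <-> forall n, f n = 0.
Proof.
move=> fF; split=> [F0 n|f0].
  by rewrite (@gf_polyP f 0) ?coef0 // polyF0 -F0.
case: fF => N [D [D0 DF Df]].
have N0 : N = 0.
  apply/polyP => n; rewrite coef0 -Df /act big1 // => k _.
  by rewrite f0 mulr0.
move/eqP: DF; rewrite N0 polyF0 mulf_eq0 polyF_eq0 => /orP[|/eqP //].
by rewrite (negPf (coef0_neq0 D0)).
Qed.

End PowerSeries.

(** * Counting integer points by level *)

Lemma finite_bounded_rows k (b : nat) :
  finite_set [set v : 'rV[int]_k | forall i, `|v 0 i| <= b%:Z].
Proof.
pose g (f : {ffun 'I_k -> 'I_(b + b).+1}) : 'rV[int]_k := \row_i ((f i)%:Z - b%:Z).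
apply: (@sub_finite_set _ _ (g @` [set: _])); last exact/finite_image/finite_finset.
move=> v /= vb; exists [ffun i => inord (absz (v 0 i + b%:Z))] => //.
apply/rowP => i; rewrite !mxE ffunE; have := vb i; rewrite ler_norml => /andP[h1 h2].
have h : (absz (v 0 i + b%:Z))%:Z = v 0 i + b%:Z by lia.
by rewrite inordK ?h ?addrK //; lia.
Qed.

Section Counting.
Variable d : nat.
Implicit Types (S X : set 'rV[int]_(d + 1)) (v w : 'rV[int]_(d + 1)).

Definition level (n : nat) : set 'rV[int]_(d + 1) := [set v | u v = n%:Z].

(** On an infinite set [fset_set] is empty, so the count is meaningful only under [level_finite]. *)
Definition cnt S (n : nat) : rat := (#|` fset_set (S `&` level n)|)%:R.

Definition level_finite S := forall n, finite_set (S `&` level n).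

Lemma uD v w : u (v + w) = u v + u w.
Proof. by rewrite /u mxE. Qed.

Lemma cntU S X n : level_finite S -> level_finite X -> S `&` X = set0 ->
  cnt (S `|` X) n = cnt S n + cnt X n.
Proof.
move=> fS fX SX; rewrite /cnt setIUl fset_setU // -natrD -cardfsUI.
suff -> : (fset_set (S `&` level n) `&` fset_set (X `&` level n))%fset = fset0.
  by rewrite cardfs0 addn0.
by rewrite -fset_setI // setIACA SX set0I fset_set0.
Qed.

Lemma level_finite_bigcup (I : eqType) (s : seq I) (S : I -> set 'rV[int]_(d + 1)) :
  (forall i, i \in s -> level_finite (S i)) ->
  level_finite (\bigcup_(i in [set` s]) S i).
Proof.
move=> fS n; rewrite setI_bigcupl; apply: bigcup_finite; first exact: finite_seq.
by move=> j /= js; apply: fS.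
Qed.

Lemma cnt_bigcup (I : choiceType) (s : seq I) (S : I -> set 'rV[int]_(d + 1)) n :
  uniq s -> (forall i, i \in s -> level_finite (S i)) ->
  (forall i j, i \in s -> j \in s -> i != j -> S i `&` S j = set0) ->
  cnt (\bigcup_(i in [set` s]) S i) n = \sum_(i <- s) cnt (S i) n.
Proof.
elim: s => [|i s IH] us fS dS.
  rewrite big_nil /cnt (_ : \bigcup_(i in _) _ = set0) ?set0I ?fset_set0 ?cardfs0 //.
  by apply/seteqP; split=> v // [].
move: us => /= /andP[iNs us].
have fS' j : j \in s -> level_finite (S j) by move=> js; apply: fS; rewrite inE js orbT.
have := IH us fS' (fun j k js ks => dS j k (mem_behead (js : j \in behead (i :: s)))
  (mem_behead (ks : k \in behead (i :: s)))).
rewrite big_cons => <-.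
have -> : \bigcup_(j in [set` i :: s]) S j = S i `|` \bigcup_(j in [set` s]) S j.
  apply/seteqP; split=> v.
    by case=> j /=; rewrite inE => /orP[/eqP -> Sv|js Sv]; [left|right; exists j].
  by case=> [Sv|[j /= js Sv]]; [exists i|exists j] => //=; rewrite ?mem_head // inE js orbT.
apply: cntU; first by apply: fS; rewrite mem_head.
- exact: level_finite_bigcup.
- apply/seteqP; split=> v // [Siv [j /= js Sjv]].
  suff ij : S i `&` S j = set0 by have : (S i `&` S j) v by []; rewrite ij.
  apply: dS; rewrite ?mem_head // ?inE ?js ?orbT //.
  by apply: contraNneq iNs => ->.
Qed.

Lemma cnt_shift w q S n : u w = q%:Z -> level_finite S ->
  (forall v, S v -> 0 <= u v) ->
  cnt [set v + w | v in S] n = act 'X^q (cnt S) n.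
Proof.
move=> uw fS S0; rewrite act_Xn; case: leqP => qn; last first.
  rewrite /cnt (_ : _ `&` _ = set0) ?fset_set0 ?cardfs0 //.
  apply/seteqP; split=> // _ [[v Sv <-]]; rewrite /level /= uD uw => uv.
  by have := S0 v Sv; lia.
rewrite /cnt (_ : _ `&` _ = [set v + w | v in S `&` level (n - q)%N]).
  by rewrite fset_set_image // card_imfset //; apply: addIr.
apply/seteqP; split=> [_ [[v Sv <-]]|_ [v [Sv uv] <-]].
  rewrite /level /= uD uw => uv; exists v => //; split=> //=; lia.
by split; [exists v|rewrite /level /= uD uw uv; lia].
Qed.

Lemma sum_level_poly S : finite_set S -> (forall v, S v -> 0 <= u v) ->
  \sum_(v \in S) (polyF 'X) ^ u v = polyF (\sum_(v <- fset_set S) 'X^(absz (u v))).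
Proof.
move=> fS S0; rewrite fsbig_finite //= /polyF rmorph_sum /=; apply: eq_big_seq => v.
rewrite in_fset_set // inE => Sv; rewrite rmorphXn /=.
by rewrite -{1}(gez0_abs (S0 v Sv)).
Qed.

Lemma gf_finite S : finite_set S -> (forall v, S v -> 0 <= u v) ->
  is_gf (cnt S) (\sum_(v \in S) (polyF 'X) ^ u v).
Proof.
move=> fS S0; rewrite sum_level_poly //.
apply: gf_ext (gf_coef _) => n; rewrite coef_sum /cnt.
under eq_bigr do rewrite coefXn.
rewrite -natr_sum -big_mkcond /= sum1_count; congr (_%:R).
have -> : fset_set (S `&` level n) = [fset v in fset_set S | n == absz (u v)]%fset.
  apply/fsetP => v; have fSn : finite_set (S `&` level n).
    by apply: sub_finite_set fS => w [].
  rewrite in_fset_set // in_fset /= !inE /= in_fset_set //.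
  apply/idP/andP => [|[]]; rewrite !inE.
    by move=> [Sv uv]; split=> //; rewrite uv.
  by move=> Sv /eqP nE; split=> //; rewrite /level /= nE gez0_abs // S0.
rewrite -sum1_count -sum1_size -[RHS]/(\sum_(v <- [fset v in _ | _]%fset) 1)%N.
by rewrite big_fset.
Qed.

End Counting.

(** * Integer points with constrained coordinates *)

Section CoordinateSets.
Variables (R : realType) (d : nat).
Local Notation V := 'rV[int]_(d + 1).
Local Notation ir := (@int_to_real R (d + 1)%N).
Implicit Types (W O C : {fset V}) (Q : V -> set R) (A B : set R) (v w : V).

Lemma int_to_realD v w : ir (v + w) = ir v + ir w.
Proof. by apply/rowP => i; rewrite !mxE intrD. Qed.

Lemma int_to_realB v w : ir (v - w) = ir v - ir w.
Proof. by apply/rowP => i; rewrite !mxE intrB. Qed.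

(** Boxes, open cones and their mixtures differ only in the constraint put on each coordinate, so
    one set of counting lemmas serves all of them. *)
Definition coordset W Q : set V := [set v | exists lam : V -> R,
  (forall w, w \in W -> Q w (lam w)) /\ ir v = \sum_(w <- W) lam w *: ir w].

Definition upd Q w A : V -> set R := fun v => if v == w then A else Q v.

Lemma sub_coordset W Q Q' : (forall w, w \in W -> Q w `<=` Q' w) ->
  coordset W Q `<=` coordset W Q'.
Proof. by move=> QQ v [lam [lQ vE]]; exists lam; split=> // w wW; apply/QQ/lQ. Qed.

Lemma eq_coordset W Q Q' : (forall w, w \in W -> Q w = Q' w) ->
  coordset W Q = coordset W Q'.
Proof. by move=> QQ; apply/seteqP; split; apply: sub_coordset => w /QQ ->. Qed.

Lemma coord_level W v (lam : V -> R) : ir v = \sum_(w <- W) lam w *: ir w ->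
  (u v)%:~R = \sum_(w <- W) lam w * (u w)%:~R.
Proof.
move=> /rowP/(_ (rshift d ord0)); rewrite mxE => ->; rewrite summxE.
by apply: eq_bigr => w _; rewrite !mxE.
Qed.

Lemma finite_coordset W (n : nat) :
  finite_set (coordset W (fun=> [set x | 0 <= x <= n%:R])).
Proof.
apply: sub_finite_set
  (finite_bounded_rows (d + 1)%N (n * \sum_(w <- W) \sum_j absz (w ord0 j))%N).
move=> v [lam [lQ /rowP vE]] i; rewrite -(ler_int R) intr_norm.
have := vE i; rewrite mxE => ->; rewrite summxE.
apply: le_trans (ler_norm_sum _ _ _) _.
rewrite -[X in _ <= X]/((n * \sum_(w <- W) \sum_j absz (w ord0 j))%N%:R) natrM natr_sum.
rewrite mulr_sumr !big_seq; apply: ler_sum => w wW; rewrite !mxE normrM.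
have /= /andP[l0 ln] := lQ w wW.
rewrite (ger0_norm l0) ler_pM // -intr_norm -[X in _ <= X]/((\sum_j absz (w ord0 j))%N%:~R).
rewrite ler_int (bigD1 i) //= PoszD -abszE lerDl; lia.
Qed.

Lemma coordset_u_ge0 W Q : (forall w, w \in W -> 0 < u w) ->
  (forall w, w \in W -> Q w `<=` [set x | 0 <= x]) ->
  forall v, coordset W Q v -> 0 <= u v.
Proof.
move=> uW Q0 v [lam [lQ /coord_level uE]]; rewrite -(ler_int R) uE big_seq.
apply: sumr_ge0 => w wW; apply: mulr_ge0; first exact: (Q0 w wW _ (lQ w wW)).
by rewrite ler0z ltW ?uW.
Qed.

(** Generators have integer height at least 1 and coordinates are nonnegative, so at level [n] no
    coordinate exceeds [n]. *)
Lemma coordset_level_finite W Q : (forall w, w \in W -> 0 < u w) ->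
  (forall w, w \in W -> Q w `<=` [set x | 0 <= x]) -> level_finite (coordset W Q).
Proof.
move=> uW Q0 n; apply: sub_finite_set (finite_coordset W n).
move=> v [[lam [lQ vE]] uv]; exists lam; split=> // w wW /=.
have l0 x : x \in W -> 0 <= lam x by move=> xW; exact: (Q0 x xW _ (lQ x xW)).
rewrite l0 //=; have := coord_level vE; rewrite uv pmulrn => ->.
rewrite (big_fsetD1 w) //=; apply: le_trans (_ : lam w * (u w)%:~R <= _).
  by rewrite ler_peMr ?l0 // ler1z -gtz0_ge1 uW.
rewrite lerDl big_seq sumr_ge0 // => x; rewrite !inE => /andP[_ xW].
by rewrite mulr_ge0 ?l0 // ler0z ltW ?uW.
Qed.

Lemma coordsetU W Q w A B : w \in W -> coordset W (upd Q w (A `|` B)) =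
  coordset W (upd Q w A) `|` coordset W (upd Q w B).
Proof.
move=> wW; apply/seteqP; split=> v.
  move=> [lam [lQ vE]]; have := lQ w wW; rewrite /upd eqxx => -[lA|lB]; [left|right];
    by exists lam; split=> // x xW; have := lQ x xW; rewrite /upd; case: eqP => // ->.
case; apply: sub_coordset => x _; rewrite /upd; case: eqP => _ y Dy //.
  by left.
by right.
Qed.

Lemma coord_unique W v (lam mu : V -> R) : linearly_independent W ir ->
  ir v = \sum_(w <- W) lam w *: ir w -> ir v = \sum_(w <- W) mu w *: ir w ->
  forall w, w \in W -> lam w = mu w.
Proof.
move=> indep vl vm w wW; apply/eqP; rewrite -subr_eq0; apply/eqP.
apply: (indep (fun w => lam w - mu w)) => //.
by under eq_bigr do rewrite scalerBl; rewrite sumrB -vl -vm subrr.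
Qed.

Lemma coordset_disjoint W Q w A B : linearly_independent W ir -> w \in W ->
  A `&` B = set0 -> coordset W (upd Q w A) `&` coordset W (upd Q w B) = set0.
Proof.
move=> indep wW AB; apply/seteqP; split=> v // [[lam [lA vl]] [mu [mB vm]]].
have := lA w wW; have := mB w wW; rewrite /upd eqxx (coord_unique indep vl vm wW).
by move=> mwB mwA; have : (A `&` B) (mu w) by []; rewrite AB.
Qed.

Lemma coordset_shift W Q w A : w \in W ->
  coordset W (upd Q w [set x + 1 | x in A]) =
  [set v + w | v in coordset W (upd Q w A)].
Proof.
move=> wW; have sumw : \sum_(x <- W) (x == w)%:R *: ir x = ir w.
  rewrite (big_fsetD1 w) //= eqxx scale1r big_seq big1 ?addr0 // => x.
  by rewrite !inE => /andP[/negPf -> _]; rewrite scale0r.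
apply/seteqP; split=> [v [lam [lQ vE]]|_ [v [lam [lQ vE]] <-]].
  exists (v - w); last by rewrite subrK.
  exists (fun x => lam x - (x == w)%:R); split.
    move=> x xW; have := lQ x xW; rewrite /upd; case: eqP => [_|_]; last by rewrite subr0.
    by case=> y Ay <-; rewrite addrK.
  under eq_bigr do rewrite scalerBl.
  by rewrite sumrB sumw -vE int_to_realB.
exists (fun x => lam x + (x == w)%:R); split.
  move=> x xW; have := lQ x xW; rewrite /upd; case: eqP => [_|_]; last by rewrite addr0.
  by move=> Ax; exists (lam x).
under eq_bigr do rewrite scalerDl.
by rewrite big_split /= sumw -vE int_to_realD.
Qed.

Lemma coordset0 W Q w : w \notin W ->
  coordset (w |` W)%fset (upd Q w [set 0]) = coordset W Q.
Proof.
move=> wW; have neqw x : x \in W -> (x == w) = false.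
  by move=> xW; apply: contraNF wW => /eqP <-.
apply/seteqP; split=> v [lam [lQ vE]].
  exists lam; split.
    by move=> x xW; have := lQ x (fset1Ur _ xW); rewrite /upd neqw.
  have := lQ w (fset1U1 _ _); rewrite /upd eqxx /= => lw.
  by rewrite vE big_fsetU1 //= lw scale0r add0r.
exists (fun x => if x == w then 0 else lam x); split.
  move=> x; rewrite !inE /upd; case: eqP => //= _; exact: lQ.
rewrite big_fsetU1 //= eqxx scale0r add0r vE; apply: eq_big_seq => x xW.
by rewrite neqw.
Qed.

(** The coordinate at [w] is below 1 on [A] and at least 1 on the translate of [B], so the union is
    disjoint; translation by [w] raises the level by [q], which multiplies the series by [z^q]. *)
Lemma cnt_peel W Q w (q : nat) A B n : linearly_independent W ir -> w \in W ->
  (forall x, x \in W -> 0 < u x) -> u w = q%:Z ->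
  (forall x, x \in W -> Q x `<=` [set y | 0 <= y]) ->
  A `<=` [set y | 0 <= y < 1] -> B `<=` [set y | 0 <= y] ->
  cnt (coordset W (upd Q w (A `|` [set x + 1 | x in B]))) n =
  cnt (coordset W (upd Q w A)) n + act 'X^q (cnt (coordset W (upd Q w B))) n.
Proof.
move=> indep wW uW uw Q0 A0 B0; rewrite coordsetU //.
have nn D : D `<=` [set y | 0 <= y] ->
    forall x, x \in W -> upd Q w D x `<=` [set y | 0 <= y].
  by move=> D0 x xW; rewrite /upd; case: eqP => // _; apply: Q0.
have A0' : A `<=` [set y | 0 <= y] by move=> y /A0 /= /andP[].
have B1 : [set x + 1 | x in B] `<=` [set y | 0 <= y].
  by move=> _ [y /B0 /= y0 <-]; rewrite addr_ge0.
have fin D (D0 : D `<=` [set y | 0 <= y]) := coordset_level_finite uW (nn D D0).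
rewrite cntU; [|exact: fin|exact: fin|]; last first.
  apply: coordset_disjoint => //; apply/seteqP; split=> _ // [/[swap] [[y /B0 /= y0 <-]]].
  by move=> /A0 /= /andP[_]; rewrite gtrDr ltNge y0.
rewrite coordset_shift // (cnt_shift _ uw) //; first exact: fin.
exact: coordset_u_ge0 uW (nn B B0).
Qed.

Definition unit_open : set R := [set x | 0 < x < 1].
Definition pos_half : set R := [set x | 0 < x].
Definition nneg_half : set R := [set x | 0 <= x].
Definition nneg_nonint : set R := [set x | 0 <= x /\ x \isn't a Num.int].

(** The part from 1 on is the translate of the closed half-line; the extra 0 is the source of the
    cone without [w] in [cnt_mixed_cone]. *)
Lemma pos_half_peel :
  pos_half = unit_open `|` [set x + 1 | x in [set 0] `|` pos_half].
Proof.
apply/seteqP; split=> x; rewrite /pos_half /unit_open /=.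
  move=> x0; have [x1|x1] := ltP x 1; first by left; rewrite x0.
  right; exists (x - 1); last by rewrite subrK.
  by move: x1; rewrite le_eqVlt => /orP[/eqP <-|x1]; [left; rewrite subrr|right; lra].
by case=> [/andP[]//|[y [->|y0] <-]]; lra.
Qed.

Lemma nneg_half_peel :
  nneg_half = ([set 0] `|` unit_open) `|` [set x + 1 | x in nneg_half].
Proof.
apply/seteqP; split=> x; rewrite /nneg_half /unit_open /=.
  move=> x0; have [x1|x1] := ltP x 1; last by right; exists (x - 1); lra.
  left; move: x0; rewrite le_eqVlt => /orP[/eqP <-|x0]; first by left.
  by right; rewrite x0.
by case=> [[->//|/andP[/ltW]//]|[y y0 <-]]; lra.
Qed.

(** Nonintegrality is invariant under the shift and already excludes 0, so no boundary term
    appears. *)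
Lemma nneg_nonint_peel :
  nneg_nonint = unit_open `|` [set x + 1 | x in nneg_nonint].
Proof.
apply/seteqP; split=> x; rewrite /nneg_nonint /unit_open /=.
  move=> [x0 xN]; have [x1|x1] := ltP x 1.
    left; apply/andP; split=> //; rewrite lt_def x0 andbT; apply: contraNneq xN => ->.
    exact: rpred0.
  right; exists (x - 1); last by rewrite subrK.
  by split; [lra|rewrite rpredBr ?rpred1].
case=> [/andP[x0 x1]|[y [y0 yN] <-]]; last by split; [lra|rewrite rpredDr ?rpred1].
split; first exact: ltW.
apply/negP => /intrP[m mE]; move: x0 x1; rewrite mE ltr0z -[1]/(1%:~R) ltr_int; lia.
Qed.

(** Interpolates between the open cone ([O] empty) and the open box ([C] empty), so that coordinates
    can be reduced modulo 1 one generator at a time. *)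
Definition mixed_cone O C := coordset (O `|` C)%fset
  (fun w => if w \in O then unit_open else pos_half).

Lemma mixed_cone_nneg O w :
  (if w \in O then unit_open else pos_half) `<=` [set y | 0 <= y].
Proof.
case: ifP => _ y; rewrite /unit_open /pos_half /=; first by case/andP => /ltW.
exact: ltW.
Qed.

(** Peeling [w] from the series [F] of the cone gives [F = F1 + z^q (F0 + F)], where the coordinate
    at [w] is in [(0,1)] for [F1] and 0 for [F0]; the last term is moved to the left. *)
Lemma cnt_mixed_cone O C w (q : nat) n : w \notin (O `|` C)%fset ->
  linearly_independent (w |` (O `|` C))%fset ir ->
  (forall x, x \in (w |` (O `|` C))%fset -> 0 < u x) -> u w = q%:Z ->
  act (1 - 'X^q) (cnt (mixed_cone O (w |` C)%fset)) n =
  cnt (mixed_cone (w |` O)%fset C) n + act 'X^q (cnt (mixed_cone O C)) n.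
Proof.
move=> wN indep uW uw; have wO : w \notin O.
  by apply: contra wN => wO; rewrite inE wO.
pose Q := fun x => if x \in O then unit_open else pos_half.
have eqO A x : A = pos_half -> upd Q w A x = Q x.
  by move=> ->; rewrite /upd /Q; case: eqP => // ->; rewrite (negPf wO).
have SE : mixed_cone O (w |` C)%fset = coordset (w |` (O `|` C))%fset (upd Q w pos_half).
  by rewrite /mixed_cone fsetUCA; apply: eq_coordset => x _; rewrite eqO.
have SO : mixed_cone (w |` O)%fset C = coordset (w |` (O `|` C))%fset (upd Q w unit_open).
  rewrite /mixed_cone -fsetUA; apply: eq_coordset => x _.
  by rewrite !inE /upd /Q; case: eqP.
have S0 : mixed_cone O C = coordset (w |` (O `|` C))%fset (upd Q w [set 0]).
  by rewrite coordset0.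
have wW := fset1U1 w (O `|` C)%fset.
rewrite act_1subXn SE {1}pos_half_peel (@cnt_peel _ _ _ q) //; first last.
- by move=> y [->//=|/= /ltW].
- by move=> y /= /andP[/ltW -> ->].
- by move=> x _; apply: mixed_cone_nneg.
rewrite -SO -addrA; congr (_ + _).
rewrite [X in X - _](eq_act _ _ (g := fun n => cnt (mixed_cone O C) n +
    cnt (coordset (w |` (O `|` C))%fset (upd Q w pos_half)) n)).
  by rewrite actDr addrK.
move=> m; rewrite coordsetU // cntU ?S0 //.
- apply: coordset_level_finite => // x _; rewrite /upd.
  by case: eqP => [_ y -> /=|_]; [|exact: (@mixed_cone_nneg O x)].
- apply: coordset_level_finite => // x _; rewrite eqO //.
  exact: mixed_cone_nneg.
- apply: coordset_disjoint => //; apply/seteqP; split=> y // [/= ->].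
  by rewrite /pos_half /= ltxx.
Qed.

Lemma open_box_finite O : finite_set (open_box R O).
Proof.
apply: sub_finite_set (finite_coordset O 1).
by apply: (@sub_coordset _ (fun=> unit_open)) => w _ y /= /andP[/ltW -> /ltW].
Qed.

Lemma open_box_u_ge0 O : (forall x, x \in O -> 0 < u x) ->
  forall v, open_box R O v -> 0 <= u v.
Proof.
by move=> uO; apply: (@coordset_u_ge0 _ (fun=> unit_open)) => // w _ y /= /andP[/ltW].
Qed.

Lemma gf_open_box O : (forall x, x \in O -> 0 < u x) ->
  is_gf (cnt (mixed_cone O fset0)) (boxB R O (polyF 'X)).
Proof.
move=> uO; have -> : mixed_cone O fset0 = open_box R O.
  rewrite -[RHS]/(coordset O (fun=> unit_open)) /mixed_cone fsetU0.
  by apply: eq_coordset => w ->.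
exact: gf_finite (@open_box_finite O) (open_box_u_ge0 uO).
Qed.

Lemma boxB_poly O : (forall x, x \in O -> 0 < u x) ->
  exists p, boxB R O (polyF 'X) = polyF p.
Proof.
by move=> uO; rewrite /boxB (sum_level_poly (@open_box_finite O) (open_box_u_ge0 uO)); eexists.
Qed.

End CoordinateSets.

(** * Generating functions of cones *)

Lemma sum_fpowersetU1 (I : choiceType) (V : nmodType) (C : {fset I}) v
    (F : {fset I} -> V) : v \notin C ->
  \sum_(Psi <- fpowerset (v |` C)%fset) F Psi =
  \sum_(Psi <- fpowerset C) F Psi + \sum_(Psi <- fpowerset C) F (v |` Psi)%fset.
Proof.
move=> vC; rewrite (big_fsetID _ (fun Psi : {fset I} => v \notin Psi)) /=; congr (_ + _).
  congr (\sum_(i <- enum_fset _) _); apply/fsetP => Psi; rewrite !inE /= !fpowersetE.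
  apply/andP/idP => [[/fsubsetP sub vN]|/fsubsetP sub].
    apply/fsubsetP => x xP; have := sub x xP; rewrite !inE => /orP[/eqP xv|//].
    by rewrite -xv xP in vN.
  split; first by apply/fsubsetP => x xP; rewrite !inE sub ?orbT.
  by apply: contra vC => /sub.
have -> : [fset Psi in fpowerset (v |` C) | ~~ (v \notin Psi)]%fset =
    [fset (v |` Psi)%fset | Psi in fpowerset C]%fset.
  apply/fsetP => Psi; rewrite !inE /= fpowersetE negbK.
  apply/andP/imfsetP => [[sub vP]|[Phi /= + ->]].
    exists (Psi `\ v)%fset; last by rewrite fsetD1K.
    rewrite /= fpowersetE; apply/fsubsetP => x; rewrite !inE => /andP[xv xP].
    by have := fsubsetP sub x xP; rewrite !inE (negPf xv).
  by rewrite fpowersetE => sub; rewrite fset1U1 fsetUS.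
rewrite big_imfset //= => Psi Phi; rewrite !fpowersetE => sP sF eqP.
have vP X : (X `<=` C)%fset -> ((v |` X) `\ v)%fset = X.
  by move=> sX; apply: fsetU1K; apply: contra vC; apply: (fsubsetP sX).
by rewrite -(vP Psi sP) eqP vP.
Qed.

Lemma sub_linearly_independent (R : realType) k (I : choiceType) (W W' : {fset I})
    (g : I -> 'rV[R]_k) : (W' `<=` W)%fset ->
  linearly_independent W g -> linearly_independent W' g.
Proof.
move=> sub indep lam l0 v vW'.
have := indep (fun v => if v \in W' then lam v else 0) _ v (fsubsetP sub v vW').
rewrite vW'; apply; rewrite -[RHS]l0 -(big_fset_incl _ sub).
  by apply: eq_big_seq => w ->.
by move=> w _ /negPf ->; rewrite scale0r.
Qed.

Section MixedConeSeries.
Variables (R : realType) (d q : nat) (I : choiceType) (g : I -> 'rV[int]_(d + 1)).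
Hypothesis q_gt0 : (0 < q)%N.
Hypothesis ug : forall v, u (g v) = q%:Z.
Local Notation ir := (@int_to_real R (d + 1)%N).
Local Notation z := (polyF 'X).
Local Notation gen C := [fset g v | v in C]%fset.

Lemma polyF_1subXn m : polyF (1 - 'X^m) = 1 - z ^+ m.
Proof. by rewrite /polyF rmorphB rmorph1 rmorphXn. Qed.

Lemma coef0_1subXn m : (0 < m)%N -> (1 - 'X^m : {poly rat})`_0 != 0.
Proof. by case: m => // m _; rewrite coefB coef1 coefXn subr0 oner_neq0. Qed.

Lemma one_sub_zXn_neq0 m : (0 < m)%N -> 1 - z ^+ m != 0.
Proof. by move=> m0; rewrite -polyF_1subXn polyF_eq0 coef0_neq0 ?coef0_1subXn. Qed.

(** [Psi] collects the vertices of [C] with nonintegral coordinate. The integer part of such a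
    coordinate contributes [1/(1 - z^q)]; a positive integral coordinate contributes
    [z^q/(1 - z^q)]. *)
Lemma gf_mixed_cone C O : {in C &, injective g} ->
  (forall v, v \in C -> g v \notin O) -> linearly_independent (O `|` gen C)%fset ir ->
  (forall x, x \in O -> 0 < u x) ->
  is_gf (cnt (mixed_cone R O (gen C)))
    (\sum_(Psi <- fpowerset C) boxB R (O `|` gen Psi)%fset z *
      ((1 - z ^+ q)^-1 ^+ #|` Psi| * (z ^+ q / (1 - z ^+ q)) ^+ (#|` C| - #|` Psi|))).
Proof.
(* [O] is generalized because each step either moves a generator from [C] to [O] or drops it. *)
elim/finSet_rect: C O => C IH O g_inj gO indep uO.
have [->|[v vC]] := fset_0Vmem C.
  rewrite fpowerset0 big_seq_fset1 imfset0 fsetU0 cardfs0 subn0 !expr0 !mulr1.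
  exact: gf_open_box.
pose C' := (C `\ v)%fset; have vC' : v \notin C' by rewrite !inE eqxx.
have CE : C = (v |` C')%fset by rewrite fsetD1K.
have sC' : (C' `<=` C)%fset by apply: fsubD1set.
have pC' : (C' `<` C)%fset by rewrite fproperD1.
have genE X : gen (v |` X)%fset = (g v |` gen X)%fset by rewrite imfsetU1.
have g_inj' : {in C' &, injective g}.
  by move=> x y xC yC; apply: g_inj; apply: (fsubsetP sC').
have gvO : g v \notin O by apply: gO.
have gvC' : g v \notin gen C'.
  apply/imfsetP => -[x /= xC' gx]; have vx := g_inj v x vC (fsubsetP sC' x xC') gx.
  by rewrite vx xC' in vC'.
rewrite CE genE fsetUCA in indep.
have gO1 x : x \in C' -> g x \notin (g v |` O)%fset.
  move=> xC'; rewrite !inE negb_or gO ?(fsubsetP sC') // andbT.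
  by apply: contra gvC' => /eqP <-; apply/imfsetP; exists x.
have uO1 x : x \in (g v |` O)%fset -> 0 < u x.
  by rewrite !inE => /orP[/eqP ->|/uO//]; rewrite ug ltz_nat.
have indep1 : linearly_independent ((g v |` O) `|` gen C')%fset ir by rewrite -fsetUA.
have indep2 : linearly_independent (O `|` gen C')%fset ir.
  by apply: sub_linearly_independent indep; apply: fsubsetUr.
have G1 := IH C' pC' (g v |` O)%fset g_inj' gO1 indep1 uO1.
have G2 := IH C' pC' O g_inj' (fun x xC' => gO x (fsubsetP sC' x xC')) indep2 uO.
have step n : act (1 - 'X^q) (cnt (mixed_cone R O (gen C))) n =
    cnt (mixed_cone R (g v |` O)%fset (gen C')) n +
    act 'X^q (cnt (mixed_cone R O (gen C'))) n.
  rewrite CE genE; apply: (cnt_mixed_cone n _ indep _ (ug v)).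
    by rewrite inE negb_or gvO.
  move=> x; rewrite !inE => /or3P[/eqP ->||/imfsetP[y /= _ ->]]; rewrite ?ug ?ltz_nat //.
  exact: uO.
have G := gf_div (coef0_1subXn q_gt0)
  (gf_ext (fun n => esym (step n)) (gfD G1 (gf_act 'X^q G2))).
rewrite polyF_1subXn in G; move: G; congr is_gf.
rewrite CE sum_fpowersetU1 // mulrDl addrC; congr (_ + _).
  rewrite mulr_sumr mulr_suml; apply: eq_big_seq => Psi; rewrite fpowersetE => sP.
  rewrite cardfsU1 vC' add1n subSn ?fsubset_leq_card // exprS.
  by rewrite [polyF 'X^q](rmorphXn _ q 'X) /=; ring.
rewrite mulr_suml; apply: eq_big_seq => Psi; rewrite fpowersetE => sP.
have vP : v \notin Psi by apply: contra vC'; apply: (fsubsetP sP).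
rewrite !cardfsU1 vC' vP !add1n subSS exprS genE fsetUCA fsetUA; ring.
Qed.

End MixedConeSeries.

Section ApexSeries.
Variables (R : realType) (d : nat) (a : 'rV[int]_(d + 1)) (C : {fset 'rV[int]_(d + 1)}).
Local Notation ir := (@int_to_real R (d + 1)%N).
Hypothesis ua : u a = 1.
Hypothesis aC : a \notin C.
Hypothesis uC : forall x, x \in C -> 0 < u x.
Hypothesis indep : linearly_independent (a |` C)%fset ir.

(** [M] constrains the apex coordinate, which is [t - s(x)] by [apex_coneP]. The other coordinates
    stay positive, so that different simplices give disjoint sets. *)
Definition apex_cone (M : set R) := coordset (a |` C)%fset (upd (fun=> @pos_half R) a M).

Let uW x : x \in (a |` C)%fset -> 0 < u x.
Proof. by rewrite !inE => /orP[/eqP ->|/uC//]; rewrite ua. Qed.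

Let pos_nneg : @pos_half R `<=` [set y | 0 <= y].
Proof. by move=> y /ltW. Qed.

Lemma apex_cone_level_finite M : M `<=` [set y | 0 <= y] -> level_finite (apex_cone M).
Proof.
move=> M0; apply: coordset_level_finite => // x _.
by rewrite /upd; case: eqP.
Qed.

Let mixed0 : mixed_cone R fset0 C = apex_cone [set 0].
Proof. by rewrite /apex_cone coordset0 // /mixed_cone fset0U; apply: eq_coordset. Qed.

Let mixed1 : mixed_cone R [fset a]%fset C = apex_cone (@unit_open R).
Proof. by apply: eq_coordset => x _; rewrite /upd inE. Qed.

(** The apex has height 1, so multiplying by [1 - z] leaves the apex coordinates 0 and [(0,1)]: the
    two terms that lead to [a] and to [z b]. *)
Lemma cnt_apex_cone_nneg n : act (1 - 'X^1) (cnt (apex_cone (@nneg_half R))) n =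
  cnt (mixed_cone R fset0 C) n + cnt (mixed_cone R [fset a]%fset C) n.
Proof.
have uo0 : @unit_open R `<=` [set y | 0 <= y] by move=> y /= /andP[/ltW].
rewrite act_1subXn {1}/apex_cone {1}nneg_half_peel (@cnt_peel _ _ _ _ _ 1) ?fset1U1 //.
  rewrite addrK coordsetU ?fset1U1 // cntU ?mixed0 ?mixed1 //.
  - by apply: apex_cone_level_finite => y ->; rewrite /= lexx.
  - exact: apex_cone_level_finite.
  - apply: coordset_disjoint; rewrite ?fset1U1 //; apply/seteqP; split=> y // [/= ->].
    by rewrite /unit_open /= ltxx.
by move=> y [->|/= /andP[/ltW -> ->//]]; rewrite /= lexx ltr01.
Qed.

Lemma cnt_apex_cone_nonint n : act (1 - 'X^1) (cnt (apex_cone (@nneg_nonint R))) n =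
  cnt (mixed_cone R [fset a]%fset C) n.
Proof.
rewrite act_1subXn {1}/apex_cone {1}nneg_nonint_peel (@cnt_peel _ _ _ _ _ 1) ?fset1U1 //.
- by rewrite addrK mixed1.
- by move=> y /= /andP[/ltW -> ->].
- by move=> y [].
Qed.

End ApexSeries.

(** * The cone over the polytope *)

Section Denominator.

Lemma dvdn_biglcm_seq (I : eqType) (s : seq I) (F : I -> nat) i : i \in s ->
  (F i %| \big[lcmn/1%N]_(j <- s) F j)%N.
Proof.
elim: s => // j s IH; rewrite inE big_cons => /orP[/eqP ->|/IH h].
  exact: dvdn_lcml.
exact: dvdn_trans h (dvdn_lcmr _ _).
Qed.

Lemma biglcm_gt0 (I : Type) (s : seq I) (F : I -> nat) : (forall i, (0 < F i)%N) ->
  (0 < \big[lcmn/1%N]_(j <- s) F j)%N.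
Proof.
move=> F0; elim: s => [|i s IH]; first by rewrite big_nil.
by rewrite big_cons lcmn_gt0 F0.
Qed.

Variables (d : nat) (T : {fset {fset 'rV[rat]_d}}).

Lemma denominator_gt0 : (0 < denominator T)%N.
Proof.
apply: biglcm_gt0 => Om; apply: biglcm_gt0 => v; apply: biglcm_gt0 => i.
by rewrite absz_gt0 denq_eq0.
Qed.

Lemma denominator_dvd Om v i : Om \in T -> v \in Om ->
  (absz (denq (v ord0 i)) %| denominator T)%N.
Proof.
move=> OT vO; have h1 := dvdn_biglcm_seq (fun Om : {fset 'rV[rat]_d} =>
  \big[lcmn/1%N]_(v <- Om) \big[lcmn/1%N]_(i < d) absz (denq (v ord0 i))) OT.
have h2 := dvdn_biglcm_seq (fun v : 'rV[rat]_d =>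
  \big[lcmn/1%N]_(i < d) absz (denq (v ord0 i))) vO.
apply: dvdn_trans (dvdn_trans h2 h1).
exact: (dvdn_biglcm_seq (fun i => absz (denq (v ord0 i))) (mem_index_enum i)).
Qed.

Lemma numq_denominator Om v i : Om \in T -> v \in Om ->
  (numq ((denominator T)%:R * v 0 i))%:~R = (denominator T)%:R * v 0 i.
Proof.
move=> OT vO; have /dvdnP[k ->] := denominator_dvd i OT vO.
have den : (absz (denq (v 0 i)))%:Z = denq (v 0 i) by rewrite absz_denq.
suff -> : (k * absz (denq (v ord0 i)))%N%:R * v 0 i = (k%:Z * numq (v 0 i))%:~R.
  by rewrite numq_int.
rewrite natrM intrM -mulrA; congr (_ * _).
rewrite -[X in X * _](_ : (denq (v 0 i))%:~R = _); last by rewrite -den.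
by rewrite mulrC -[X in X * _]divq_num_den divfK // intr_eq0 denq_eq0.
Qed.

Lemma lift_vertex_real (R : realType) Om v : Om \in T -> v \in Om ->
  int_to_real R (lift_vertex (denominator T) v) =
  row_mx ((denominator T)%:R *: rat_to_real R v) (const_mx (denominator T)%:R).
Proof.
move=> OT vO; apply/rowP => i; rewrite [LHS]mxE; case: (split_ordP i) => j ->.
  rewrite /lift_vertex !row_mxEl !mxE -ratr_int (numq_denominator j OT vO).
  by rewrite rmorphM /= ratr_nat.
by rewrite /lift_vertex !row_mxEr !mxE.
Qed.

End Denominator.

Section ConePoints.
Variables (R : realType) (d : nat) (A : {fset 'rV[R]_d}).
Variable T : {fset {fset 'rV[rat]_d}}.
Hypothesis P0 : interior (conv A) 0.
Hypothesis triT : boundary_triangulation (conv A) T.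
Local Notation q := (denominator T).
Local Notation ir := (@int_to_real R (d + 1)%N).
Local Notation rr := (@rat_to_real R d).
Implicit Types (Om Phi Psi : {fset 'rV[rat]_d}).

Lemma u_lift_vertex v : u (lift_vertex q v : 'rV[int]_(d + 1)) = q%:Z.
Proof. by rewrite /u /lift_vertex row_mxEr mxE. Qed.

Lemma u_apex : u (apex d) = 1.
Proof. by rewrite /u /apex row_mxEr mxE. Qed.

Let qR : (q%:R : R) != 0.
Proof. by rewrite pnatr_eq0 -lt0n denominator_gt0. Qed.

Lemma lift_vertex_inj Om : Om \in T -> {in Om &, injective (@lift_vertex d q)}.
Proof.
move=> OT v w vO wO vw; apply: (@rat_to_real_inj R); apply: (scalerI qR).
have := congr1 ir vw; rewrite !(lift_vertex_real R OT) //.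
by move=> /eq_row_mx[].
Qed.

Lemma int_to_real_row (v : 'rV[int]_(d + 1)) :
  ir v = row_mx (int_to_real R (lsubmx v)) (const_mx (u v)%:~R).
Proof.
apply/rowP => i; rewrite [LHS]mxE; case: (split_ordP i) => j ->.
  by rewrite row_mxEl !mxE.
by rewrite row_mxEr mxE ord1.
Qed.

Lemma int_to_real_apex : ir (apex d) = row_mx 0 (const_mx 1).
Proof.
by rewrite int_to_real_row u_apex /apex row_mxKl; congr row_mx; apply/rowP => i; rewrite !mxE.
Qed.

Lemma cone_combination Om (nu : 'rV[rat]_d -> R) (mu : R) : Om \in T ->
  mu *: ir (apex d) + \sum_(v <- Om) nu v *: ir (lift_vertex q v) =
  row_mx (\sum_(v <- Om) (nu v * q%:R) *: rr v)
         (const_mx (mu + \sum_(v <- Om) nu v * q%:R)).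
Proof.
move=> OT; rewrite int_to_real_apex scale_row_mx scaler0.
rewrite (eq_big_seq (fun v => row_mx ((nu v * q%:R) *: rr v) (const_mx (nu v * q%:R)))).
  elim: (Om : seq _) mu => [|v s IH] mu.
    by rewrite !big_nil !addr0; congr row_mx; apply/rowP => i; rewrite !mxE mulr1.
  rewrite !big_cons addrCA IH add_row_mx; congr row_mx.
  by apply/rowP => i; rewrite !mxE addrCA.
move=> v vO; rewrite (lift_vertex_real R OT vO) scale_row_mx scalerA.
by congr row_mx; apply/rowP => i; rewrite !mxE.
Qed.

(** Equality would put a vertex at the origin, which linear independence of the vertices
    excludes. *)
Lemma apex_notin_coneW Om : Om \in T -> apex d \notin coneW q Om.
Proof.
move=> OT; apply/imfsetP => -[v /= vO av].
have v0 : rr v = 0.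
  have := congr1 ir av; rewrite (lift_vertex_real R OT vO) int_to_real_row.
  move=> /eq_row_mx[]; rewrite /apex row_mxKl => e _.
  apply: (scalerI qR); rewrite -e scaler0; apply/rowP => i.
  by rewrite !mxE.
have := simplex_linearly_independent P0 triT OT (lam := fun w => (w == v)%:R) _ vO.
rewrite eqxx => /(_ _)/eqP; rewrite oner_eq0 => H; apply: notF; apply: H.
rewrite big_seq big1 // => w _; case: eqP => [->|_]; last by rewrite scale0r.
by rewrite v0 scaler0.
Qed.

Lemma apex_cone_independent Om : Om \in T ->
  linearly_independent (apex d |` coneW q Om)%fset ir.
Proof.
move=> OT lam; rewrite big_fsetU1 ?apex_notin_coneW //= sum_imfset; last first.
  exact: lift_vertex_inj.
rewrite (cone_combination (fun v => lam (lift_vertex q v))) // => l0.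
have /eq_row_mx[lO la] : row_mx (\sum_(v <- Om) (lam (lift_vertex q v) * q%:R) *: rr v)
   (const_mx (lam (apex d) + \sum_(v <- Om) lam (lift_vertex q v) * q%:R)) =
   row_mx 0 (const_mx 0) :> 'rV[R]_(d + 1).
  have c0 : const_mx 0 = 0 :> 'rV[R]_1 by apply/rowP => i; rewrite !mxE.
  by rewrite l0 c0; apply/esym/row_mx0.
have lv v : v \in Om -> lam (lift_vertex q v) = 0.
  move=> vO; have /eqP := simplex_linearly_independent P0 triT OT lO vO.
  by rewrite mulf_eq0 (negPf qR) orbF => /eqP.
move=> w; rewrite !inE => /orP[/eqP ->|/imfsetP[v /= vO ->]]; last exact: lv.
have := congr1 (fun M : 'rV[R]_1 => M 0 0) la; rewrite !mxE big_seq big1 ?addr0 //.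
by move=> v vO; rewrite lv ?mul0r.
Qed.

(** The coordinates of the lifted vertices are multiplied by [q] to become the weights on [Om];
    comparing last entries then identifies [mu] with [t - s(x)]. *)
Lemma apex_coneP Om (M : set R) v : Om \in T ->
  apex_cone (apex d) (coneW q Om) M v <->
  exists (lam : 'rV[rat]_d -> R) mu, [/\ forall r, r \in Om -> 0 < lam r, M mu,
    int_to_real R (lsubmx v) = \sum_(r <- Om) lam r *: rr r &
    (u v)%:~R = mu + \sum_(r <- Om) lam r].
Proof.
move=> OT; have aN := apex_notin_coneW OT; have inj := lift_vertex_inj OT.
have q0 : (0 : R) < q%:R by rewrite ltr0n denominator_gt0.
split=> [[lam [lQ]]|[lam [mu [l0 Mmu xE uE]]]].
  rewrite big_fsetU1 //= sum_imfset // (cone_combination (fun v => lam (lift_vertex q v))) //.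
  rewrite int_to_real_row => /eq_row_mx[xE uE].
  exists (fun r => lam (lift_vertex q r) * q%:R), (lam (apex d)); split=> //.
  - move=> r rO; rewrite mulr_gt0 //; have := lQ (lift_vertex q r).
    have rC : lift_vertex q r \in coneW q Om by apply/imfsetP; exists r.
    rewrite !inE rC orbT => /(_ isT); rewrite /upd.
    by case: eqP => [ra|//]; rewrite -ra rC in aN.
  - by have := lQ _ (fset1U1 _ _); rewrite /upd eqxx.
  - by have := congr1 (fun M : 'rV[R]_1 => M 0 0) uE; rewrite !mxE.
have [nu nuE] := extend_along_injection inj (fun r => lam r / q%:R).
exists (fun w => if w == apex d then mu else nu w); split.
  move=> w; rewrite !inE /upd; case: eqP => //= _ /imfsetP[r /= rO ->].
  by rewrite nuE //; apply: divr_gt0; rewrite ?l0.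
rewrite big_fsetU1 //= eqxx sum_imfset //.
transitivity (mu *: ir (apex d) + \sum_(r <- Om) (lam r / q%:R) *: ir (lift_vertex q r)).
  rewrite cone_combination // int_to_real_row xE uE.
  by congr (row_mx _ (const_mx (_ + _))); apply: eq_bigr => r _; rewrite divfK.
congr (_ + _); apply: eq_big_seq => r rO; rewrite nuE //.
have rC : lift_vertex q r \in coneW q Om by apply/imfsetP; exists r.
by case: eqP => // ra; rewrite -ra rC in aN.
Qed.

Lemma coneW_u_gt0 Om x : x \in coneW q Om -> 0 < u x.
Proof. by move=> /imfsetP[v /= _ ->]; rewrite u_lift_vertex ltz_nat denominator_gt0. Qed.

(** The relatively open cones partition the space, and membership in the [n]-th dilate means
    [s(x) <= n], that is, a nonnegative apex coordinate at height [n]. Forgetting the height is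
    injective on one level. *)
Lemma lattice_countE n : (lattice_count (conv A) n)%:R =
  \sum_(Om <- T) cnt (apex_cone (apex d) (coneW q Om) (@nneg_half R)) n :> rat.
Proof.
pose Z Om := apex_cone (apex d) (coneW q Om) (@nneg_half R).
have fZ Om : Om \in T -> level_finite (Z Om).
  by move=> OT; apply: apex_cone_level_finite => //; [exact: u_apex|exact: coneW_u_gt0].
rewrite -(@cnt_bigcup _ _ T Z) ?fset_uniq //; last first.
  move=> Om Phi OT FT OF; apply/seteqP; split=> v //.
  move=> [/(apex_coneP _ _ OT)[lam [mu [l0 _ xE _]]]].
  move=> /(apex_coneP _ _ FT)[nu [mu' [n0 _ xE' _]]].
  by move/eqP: OF; apply; apply: (cone_unique P0 triT OT FT l0 n0); rewrite -xE.
have fU := level_finite_bigcup fZ n.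
rewrite /cnt /lattice_count; congr (_%:R).
have -> : [set v : 'rV[int]_d | [set n%:R *: x | x in conv A] (int_to_real R v)] =
    [set lsubmx v | v in (\bigcup_(Om in [set` T]) Z Om) `&` level n].
  apply/seteqP; split=> [x nPx|_ [v [[Om /= OT Zv] uv] <-]].
    have [Om [lam [OT l0 xE]]] := cone_cover P0 triT (int_to_real R x).
    exists (row_mx x (const_mx n%:Z)); last by rewrite row_mxKl.
    have un : u (row_mx x (const_mx n%:Z)) = n%:Z by rewrite /u row_mxEr mxE.
    split; last by rewrite /level /=.
    exists Om => //; apply/apex_coneP => //.
    exists lam, (n%:R - \sum_(r <- Om) lam r); rewrite row_mxKl; split=> //.
      rewrite /nneg_half /= subr_ge0; apply/(cone_dilate P0 triT) => //.
        by move=> v /l0/ltW.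
      by rewrite -xE.
    by rewrite subrK un.
  move/(apex_coneP _ _ OT): Zv => [lam [mu [l0 mu0 xE uE]]].
  rewrite xE; apply/(cone_dilate P0 triT) => //.
    by move=> r /l0/ltW.
  by have : (u v)%:~R = n%:R :> R by [rewrite uv]; rewrite uE => <-; rewrite lerDr.
rewrite fset_set_image // card_in_imfset //= => v w.
rewrite !in_fset_set // !inE => -[_ uv] [_ uw] vw.
rewrite -[v]hsubmxK -[w]hsubmxK vw; congr row_mx; apply/rowP => i; rewrite !mxE ord1.
by move: uv uw; rewrite /level /= /u => -> ->.
Qed.

Lemma integral_gaugeP : integral_gauge R T <->
  forall Om, Om \in T -> apex_cone (apex d) (coneW q Om) (@nneg_nonint R) = set0.
Proof.
split=> [gZ Om OT|ZE x Om lam OT l0 xE].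
  apply/seteqP; split=> v // /(apex_coneP _ _ OT)[lam [mu [l0 [_ /negP muN] xE uE]]].
  apply: muN; have := gZ _ _ _ OT l0 xE => sZ.
  by rewrite -(rpredDr _ sZ) -uE intr_int.
apply: contrapT => /negP sN; set s := \sum_(v <- Om) lam v in sN.
(* Any integer height above a nonintegral [s] gives the apex coordinate [n - s], nonnegative and
   nonintegral. *)
pose n := Num.bound s; have s0 : 0 <= s.
  by rewrite /s big_seq sumr_ge0 // => v /l0/ltW.
have : apex_cone (apex d) (coneW q Om) (@nneg_nonint R) (row_mx x (const_mx n%:Z)).
  apply/apex_coneP => //; exists lam, (n%:R - s); rewrite row_mxKl; split=> //.
    split; first by rewrite subr_ge0 ltW // archi_boundP.
    by rewrite rpredBl ?rpred_nat // rpredN.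
  by rewrite subrK /u row_mxEr mxE.
by rewrite ZE.
Qed.

End ConePoints.

Lemma expr_div_cancel (F : fieldType) (x y : F) m k : (k <= m)%N -> x != 0 ->
  x ^+ m * (y / x) ^+ k = x ^+ (m - k) * y ^+ k.
Proof.
move=> km x0; rewrite -{1}(subnK km) exprD expr_div_n -mulrA; congr (_ * _).
by rewrite mulrC divfK // expf_neq0.
Qed.

Lemma exprB_inv (F : fieldType) (x : F) m k : (k <= m)%N -> x != 0 ->
  x ^+ (m - k) = x ^+ m * x^-1 ^+ k.
Proof.
by move=> km x0; rewrite -{2}(subnK km) exprD exprVn mulfK // expf_neq0.
Qed.

Lemma geometric_sum (F : fieldType) (x : F) n : 1 - x != 0 ->
  \sum_(i < n) x ^+ i = (1 - x ^+ n) / (1 - x).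
Proof.
move=> x1; apply: (mulIf x1); rewrite divfK // -[1 - x ^+ n]opprB subrX1 -mulNr opprB.
by rewrite mulrC.
Qed.

Lemma scale_div_exprS (F : fieldType) (x w s : F) n :
  x / w * (x ^+ n * s) = x ^+ n.+1 * (s / w).
Proof. by rewrite exprS; ring. Qed.

Lemma mulKfA (F : fieldType) (x y s : F) : x != 0 -> x * (x^-1 * y * s) = y * s.
Proof. by move=> x0; rewrite !mulrA mulfV // mul1r. Qed.

Lemma eq0_of_mul (F : fieldType) (x y b s : F) : x != 0 -> y != 0 ->
  x * b = y * s -> b = 0 <-> s = 0.
Proof.
move=> x0 y0 xy; split=> [b0|s0].
  by apply: (mulfI y0); rewrite -xy b0 !mulr0.
by apply: (mulfI x0); rewrite xy s0 !mulr0.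
Qed.

Lemma addr_mul_eqP (F : fieldType) (x a b : F) : x != 0 -> b = 0 <-> a + x * b = a.
Proof.
move=> x0; split=> [->|/eqP]; first by rewrite mulr0 addr0.
by rewrite -subr_eq0 addrAC subrr add0r mulf_eq0 (negPf x0) => /eqP.
Qed.

Section HPolynomials.
Variables (d : nat) (T : {fset {fset 'rV[rat]_d}}).
Hypothesis T_sub : forall Om Psi, Om \in T -> (Psi `<=` Om)%fset -> Psi \in T.
Hypothesis T_card : forall Om, Om \in T -> (#|` Om| <= d)%N.
Implicit Types Om Phi Psi : {fset 'rV[rat]_d}.

(** Exchanging the sums turns contributions of faces [Psi] into contributions of cones [Phi], the
    form given by [gf_mixed_cone]. The truncated exponent [d - |Psi|] is a true difference by
    [T_card], so it splits off [(1 - y)^d]. *)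
Lemma sum_h (BB : {fset 'rV[rat]_d} -> ratfun) (y : ratfun) : 1 - y != 0 ->
  \sum_(Psi <- T) BB Psi * h T Psi y =
  (1 - y) ^+ d * \sum_(Phi <- T) \sum_(Psi <- fpowerset Phi)
    BB Psi * ((1 - y)^-1 ^+ #|` Psi| * (y / (1 - y)) ^+ (#|` Phi| - #|` Psi|)).
Proof.
move=> y1; transitivity ((1 - y) ^+ d * \sum_(Phi <- T) \sum_(Psi <- T | (Psi `<=` Phi)%fset)
    BB Psi * ((1 - y)^-1 ^+ #|` Psi| * (y / (1 - y)) ^+ (#|` Phi| - #|` Psi|))); last first.
  congr (_ * _); apply: eq_big_seq => Phi FT; rewrite big_fset_condE.
  congr (\sum_(i <- enum_fset _) _); apply/fsetP => Psi; rewrite !inE /= fpowersetE.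
  by apply/andP/idP => [[]//|sub]; split=> //; apply: T_sub sub.
rewrite (exchange_big_dep predT) //= mulr_sumr; apply: eq_big_seq => Psi PT.
rewrite /h; under [in RHS]eq_bigr do rewrite mulrA.
rewrite -mulr_sumr !mulrA; congr (_ * _); rewrite -[RHS]mulrA [RHS]mulrCA; congr (_ * _).
exact: exprB_inv (T_card PT) y1.
Qed.

Definition is_poly (F : ratfun) := exists p, F = polyF p.

Lemma is_polyD F G : is_poly F -> is_poly G -> is_poly (F + G).
Proof. by move=> [p ->] [r ->]; exists (p + r); rewrite polyFD. Qed.

Lemma is_polyM F G : is_poly F -> is_poly G -> is_poly (F * G).
Proof. by move=> [p ->] [r ->]; exists (p * r); rewrite polyFM. Qed.

Lemma is_poly_sum (I : eqType) (s : seq I) (K : pred I) (F : I -> ratfun) :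
  (forall i, i \in s -> is_poly (F i)) -> is_poly (\sum_(i <- s | K i) F i).
Proof.
move=> FP; rewrite big_seq_cond; apply: big_ind.
- by exists 0; rewrite polyF0.
- exact: is_polyD.
- by move=> i /andP[/FP].
Qed.

(** The denominators have exponent at most [d - |Psi|], so the prefactor clears them. *)
Lemma is_poly_h Psi p : Psi \in T -> 1 - polyF p != 0 -> is_poly (h T Psi (polyF p)).
Proof.
move=> PT p1; rewrite /h mulr_sumr big_seq_cond; apply: big_ind.
- by exists 0; rewrite polyF0.
- exact: is_polyD.
move=> Phi /andP[FT sub].
have le1 : (#|` Phi| - #|` Psi| <= d - #|` Psi|)%N by rewrite leq_sub2r ?T_card.
exists ((1 - p) ^+ ((d - #|` Psi|) - (#|` Phi| - #|` Psi|)) * p ^+ (#|` Phi| - #|` Psi|)).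
rewrite (expr_div_cancel (polyF p) le1 p1).
by rewrite polyFM /polyF !rmorphXn rmorphB rmorph1.
Qed.

End HPolynomials.

Theorem theorem5p1 (R : realType) (d : nat) (P : set 'rV[R]_d)
    (T : {fset {fset 'rV[rat]_d}}) :
  rational_polytope P -> interior P 0 -> boundary_triangulation P T ->
  let q := denominator T in
  let z := polyF 'X in
  let a := a_fun R T z in
  let b := b_fun R T z in
  (exists hstar : {poly rat}, is_hstar P q hstar) /\
  forall hstar : {poly rat}, is_hstar P q hstar ->
    [/\ polyF hstar = a + z * b,
        lattice_polytope (dual P) <-> b = 0 &
        lattice_polytope (dual P) <-> polyF hstar = a].
Proof.
move=> [A0]; set A := [fset _ | _ in A0]%fset => PA; subst P => P0 triT.
move=> q z a b.
have T_sub Om Psi : Om \in T -> (Psi `<=` Om)%fset -> Psi \in T.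
  by case: triT => _ _ + _ _; apply.
have T_card Om : Om \in T -> (#|` Om| <= d)%N by exact: (simplex_card_le P0 triT).
have q_gt0 : (0 < q)%N := denominator_gt0 T.
have zq : 1 - z ^+ q != 0 by apply: one_sub_zXn_neq0.
have z1 : 1 - z != 0 by rewrite -[z]expr1; apply: one_sub_zXn_neq0.
have z0 : z != 0 by rewrite polyF_eq0 polyX_eq0.
have uq v : u (lift_vertex q v : 'rV[int]_(d + 1)) = q%:Z by exact: u_lift_vertex.
have uC (Om : {fset 'rV[rat]_d}) x : x \in coneW q Om -> 0 < u x.
  exact: coneW_u_gt0.
have uC' (Om : {fset 'rV[rat]_d}) x : x \in (apex d |` coneW q Om)%fset -> 0 < u x.
  by rewrite !inE => /orP[/eqP ->|/uC//]; rewrite u_apex.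
(* The weights of [gf_mixed_cone]; [G] and [G'] are the series of the points over [Phi] with apex
   coordinate 0 and in [(0,1)]. *)
pose wt (Phi Psi : {fset 'rV[rat]_d}) : ratfun :=
  (1 - z ^+ q)^-1 ^+ #|` Psi| * (z ^+ q / (1 - z ^+ q)) ^+ (#|` Phi| - #|` Psi|).
pose G (Phi : {fset 'rV[rat]_d}) := \sum_(Psi <- fpowerset Phi) B R q Psi z * wt Phi Psi.
pose G' (Phi : {fset 'rV[rat]_d}) := \sum_(Psi <- fpowerset Phi) B' R q Psi z * wt Phi Psi.
pose Z (Om : {fset 'rV[rat]_d}) := apex_cone (apex d) (coneW q Om) (@nneg_half R).
pose Z' (Om : {fset 'rV[rat]_d}) := apex_cone (apex d) (coneW q Om) (@nneg_nonint R).
have gfG Om : Om \in T -> is_gf (cnt (mixed_cone R fset0 (coneW q Om))) (G Om).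
  move=> OT; have indep : linearly_independent (fset0 `|` coneW q Om)%fset
      (@int_to_real R (d + 1)%N).
    rewrite fset0U; apply: sub_linearly_independent (apex_cone_independent P0 triT OT).
    exact: fsubsetUr.
  have out v : v \in Om -> lift_vertex q v \notin (fset0 : {fset 'rV[int]_(d + 1)}) by [].
  have u0 x : x \in (fset0 : {fset 'rV[int]_(d + 1)}) -> 0 < u x by [].
  have := gf_mixed_cone q_gt0 uq (lift_vertex_inj R OT) out indep u0.
  by under eq_bigr do rewrite fset0U.
have gfG' Om : Om \in T ->
    is_gf (cnt (mixed_cone R [fset apex d]%fset (coneW q Om))) (G' Om).
  move=> OT; apply: (gf_mixed_cone q_gt0 uq (lift_vertex_inj R OT)).
  - move=> v vO; rewrite inE; apply: contra (apex_notin_coneW P0 triT OT) => /eqP <-.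
    by apply/imfsetP; exists v.
  - exact: (apex_cone_independent P0 triT OT).
  - by move=> x; rewrite inE => /eqP ->; rewrite u_apex.
have gfZ Om : Om \in T -> is_gf (cnt (Z Om)) ((G Om + G' Om) / (1 - z)).
  move=> OT; rewrite -[z]expr1 -polyF_1subXn; apply: gf_div; first exact: coef0_1subXn.
  apply: gf_ext (gfD (gfG Om OT) (gfG' Om OT)) => n; apply/esym.
  apply: cnt_apex_cone_nneg; [exact: u_apex|exact: (apex_notin_coneW P0 triT OT)|exact: uC|].
  exact: (apex_cone_independent P0 triT OT).
have gfZ' Om : Om \in T -> is_gf (cnt (Z' Om)) (G' Om / (1 - z)).
  move=> OT; rewrite -[z]expr1 -polyF_1subXn; apply: gf_div; first exact: coef0_1subXn.
  apply: gf_ext (gfG' Om OT) => n; apply/esym.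
  apply: cnt_apex_cone_nonint; [exact: u_apex|exact: uC|].
  exact: (apex_cone_independent P0 triT OT).
have geom := geometric_sum q z1.
(* The geometric sum [(1 - z^q)/(1 - z)] raises the exponent from [d] to [d + 1] and supplies the
   denominator belonging to the apex. *)
have aE : a = (1 - z ^+ q) ^+ d.+1 * \sum_(Om <- T) G Om / (1 - z).
  rewrite /a /a_fun -/q geom (sum_h T_sub T_card (fun Psi => B R q Psi z) zq).
  by rewrite -mulr_suml; exact: scale_div_exprS.
have zbE : z * b = (1 - z ^+ q) ^+ d.+1 * \sum_(Om <- T) G' Om / (1 - z).
  rewrite /b /b_fun -/q geom (sum_h T_sub T_card (fun Psi => B' R q Psi z) zq).
  by rewrite -mulr_suml (mulKfA _ _ z0); exact: scale_div_exprS.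
have abE : a + z * b =
    polyF ((1 - 'X^q) ^+ d.+1) * \sum_(Om <- T) (G Om + G' Om) / (1 - z).
  have -> : polyF ((1 - 'X^q) ^+ d.+1) = (1 - z ^+ q) ^+ d.+1.
    by rewrite -polyF_1subXn /polyF rmorphXn.
  rewrite aE zbE -mulrDr -big_split /=.
  by congr (_ * _); apply: eq_bigr => Om _; rewrite mulrDl.
have gfP : is_gf (fun n => (lattice_count (conv A) n)%:R)
    (\sum_(Om <- T) (G Om + G' Om) / (1 - z)).
  by apply: gf_ext (gf_sum gfZ) => n; rewrite (lattice_countE P0 triT).
(* Polynomiality is read off from box polynomials and [h]; only then can [gf_polyP] compare
   coefficients and produce the numerator. *)
have [p pE] : is_poly (a + z * b).
  have zq_poly : z ^+ q = polyF 'X^q by rewrite /polyF rmorphXn.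
  have zs : is_poly (\sum_(i < q) z ^+ i).
    by apply: is_poly_sum => i _; exists 'X^i; rewrite /polyF rmorphXn.
  have hP Psi : Psi \in T -> is_poly (h T Psi (z ^+ q)).
    have p1 : 1 - polyF 'X^q != 0 by rewrite -zq_poly; exact: zq.
    by move=> PT; rewrite zq_poly; exact: (is_poly_h T_card PT p1).
  rewrite /a /b /a_fun /b_fun -/q (mulKfA _ _ z0).
  apply: is_polyD; apply: (is_polyM zs); apply: is_poly_sum => Psi PT.
    by apply: is_polyM (hP Psi PT); exact: (boxB_poly R (uC Psi)).
  by apply: is_polyM (hP Psi PT); exact: (boxB_poly R (uC' Psi)).
have hp n : act ((1 - 'X^q) ^+ d.+1) (fun n => (lattice_count (conv A) n)%:R) n = p`_n.
  by apply: gf_polyP; rewrite -pE abE; apply: gf_act.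
split; first by exists p.
move=> hs hsP; have hsE : hs = p by apply/polyP => n; rewrite -hp -hsP.
have main : lattice_polytope (dual (conv A)) <-> b = 0.
  rewrite (eq0_of_mul z0 (expf_neq0 d.+1 zq) zbE).
  rewrite (gf_eq0 (gf_sum gfZ')).
  have fin Om : level_finite (Z' Om).
    by apply: apex_cone_level_finite; [exact: u_apex|exact: uC|move=> y []].
  transitivity (integral_gauge R T).
    split; first exact: lattice_dual_integral_gauge.
    move=> gZ; apply: (integral_gauge_lattice_dual P0 triT gZ q_gt0) => Om v OT vO.
    exists (lsubmx (lift_vertex q v)); have := lift_vertex_real R OT vO.
    by rewrite int_to_real_row => /eq_row_mx[].
  rewrite (integral_gaugeP P0 triT); split=> [ZE n|cnt0 Om OT].
    rewrite big_seq big1 // => Om OT; rewrite /Z' ZE // /cnt set0I fset_set0.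
    by rewrite cardfs0.
  apply/seteqP; split=> v // Z'v.
  have uv : 0 <= u v.
    apply: coordset_u_ge0 (uC' Om) _ v Z'v => x _; rewrite /upd.
    by case: eqP => _ y; [case|move/ltW].
  (* Counts are nonnegative, so a vanishing sum makes each of them vanish; [fin] rules out a zero
     that only reflects the default value of [fset_set]. *)
  have := cnt0 (absz (u v)) => /eqP; rewrite psumr_eq0; last by move=> *; rewrite ler0n.
  move=> /allP/(_ Om OT); rewrite /= pnatr_eq0 cardfs_eq0 => /eqP/(fset_set_set0 (fin _ _)).
  suff : (Z' Om `&` level (absz (u v))) v by move=> h h0; rewrite h0 in h.
  by split=> //; rewrite /level /= gez0_abs.
by rewrite hsE -pE; split=> //; rewrite main; exact: addr_mul_eqP.
Qed.
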